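(* If a field $K$ admits a non-trivial henselian valuation, then $K$ is large.
   Context: A field $K$ is large if for every smooth curve over $K$ the set of $K$-rational points is infinite if it is non-empty; equivalently, for every function field $F|K$ in one variable the set of $K$-rational places of $F$ (places trivial on $K$ with residue field $K$) is infinite if it is non-empty. Valuations are Krull valuations (arbitrary ordered abelian value group). *)

(* Defs.v *)
From HB Require Import structures.
From mathcomp Require Import all_boot all_order all_algebra.
From mathcomp Require Import classical_sets cardinality.

Set Implicit Arguments.
Unset Strict Implicit.
Unset Printing Implicit Defensive.

Import Order.TTheory GRing.Theory Num.Theory.
Local Open Scope ring_scope.

(* A [porderZmodType] does not relate its order to its group law:
   the two conditions below make it a (totally) ordered abelian group. *)
Definition ordered_group (G : porderZmodType) : Prop :=
  (forall x y : G, (x <= y) || (y <= x)) /\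
  (forall x y z : G, x <= y -> x + z <= y + z).

(* [option G] stands for G together with a largest, absorbing element oo,
   represented by [None]. *)
Section ExtendedGroup.
Variable G : porderZmodType.

Definition oadd (x y : option G) : option G :=
  match x, y with
  | Some a, Some b => Some (a + b)
  | _, _ => None
  end.

Definition ole (x y : option G) : bool :=
  match x, y with
  | _, None => true
  | None, Some _ => false
  | Some a, Some b => a <= b
  end.

Definition olt (x y : option G) : bool := (x != y) && ole x y.

End ExtendedGroup.

Section Valuation.
Variables (K : fieldType) (G : porderZmodType).

(* The value group is the image of K^* in G; the last condition is the
   ultrametric inequality v (x + y) >= min (v x) (v y). *)
Definition valuation (v : K -> option G) : Prop :=
  [/\ ordered_group G,
      forall x, v x = None <-> x = 0,
      forall x y, v (x * y) = oadd (v x) (v y)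
    & forall x y, ole (v x) (v (x + y)) || ole (v y) (v (x + y))].

Definition nontrivial_valuation (v : K -> option G) : Prop :=
  exists2 x : K, x != 0 & v x <> Some 0.

(* Hensel's Lemma for monic polynomials over the valuation ring. *)
Definition henselian (v : K -> option G) : Prop :=
  forall (f : {poly K}) (a : K),
    f \is monic -> (forall i, ole (Some 0) (v f`_i)) ->
    ole (Some 0) (v a) -> olt (Some 0) (v f.[a]) -> v f^`().[a] = Some 0 ->
    exists2 b : K, root f b & olt (Some 0) (v (b - a)).

End Valuation.

Definition admits_nontrivial_henselian_valuation (K : fieldType) : Prop :=
  exists (G : porderZmodType) (v : K -> option G),
    [/\ valuation v, nontrivial_valuation v & henselian v].

Section FunctionField.
Variables (K F : fieldType) (iota : {rmorphism K -> F}).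

Definition in_simple_ext (t x : F) : Prop :=
  exists p q : {poly K},
    (map_poly iota q).[t] != 0 /\
    x = (map_poly iota p).[t] / (map_poly iota q).[t].

(* F, seen as an extension of K through iota, is finite over K(t) for some t
   transcendental over K. *)
Definition function_field_one_var : Prop :=
  exists t : F, ~ algebraicOver iota t /\
  exists e : seq F, forall y : F, exists c : nat -> F,
    (forall i, in_simple_ext t (c i)) /\
    y = \sum_(i < size e) c i * e`_i.

End FunctionField.

(* A place of F with values in L; [None] is the value oo. *)
Definition place (F L : fieldType) (P : F -> option L) : Prop :=
  [/\ P 1 = Some 1,
      forall x y a b, P x = Some a -> P y = Some b -> P (x + y) = Some (a + b),
      forall x y a b, P x = Some a -> P y = Some b -> P (x * y) = Some (a * b)
    & forall x, P x = None -> P x^-1 = Some 0].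

(* Places are usually identified when they have the same valuation ring. The
   class of a place trivial on K with residue field K contains exactly one
   K-valued place inducing the identity on K; distinct maps P below are thus
   distinct places. *)
Definition rational_place (K F : fieldType) (iota : {rmorphism K -> F})
    (P : F -> option K) : Prop :=
  place P /\ forall c : K, P (iota c) = Some c.

Definition large (K : fieldType) : Prop :=
  forall (F : fieldType) (iota : {rmorphism K -> F}),
    function_field_one_var iota ->
    (exists P : F -> option K, rational_place iota P) ->
    infinite_set [set P : F -> option K | rational_place iota P]%classic.

(* Main.v *)
Require Import Defs.
From HB Require Import structures.
From mathcomp Require Import all_boot all_order all_algebra.
From mathcomp Require Import separable boolp ring.
From mathcomp Require classical_sets cardinality.

(** Let [F | K] be a function field in one variable with a rational place [P],
    and let [K] carry a nontrivial henselian valuation [v]. The idea is to turn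
    [P] into a point of a plane curve at which the implicit function theorem of
    the henselian field [K] applies: it yields [K]-rational points near [P],
    and each of them is the center of a rational place.

    The maximal ideal of [P] has a generator [t] ([uniformizer_exists]), because
    elements of distinct values are linearly independent over [K(x)] when [x] is
    a zero of [P], and [F] has finite degree over [K(x)]. Since the residue field
    of [P] is [K], this [t] is a separating element: every [y] in [F] is a simple
    root of its minimal equation [f] over [K(t)] ([minimal_deriv_neq0]). In
    characteristic [p] this rests on the fact that elements independent over [K]
    have [p]-th powers which, multiplied by [1, t, ..., t ^ (p - 1)], are still
    independent over [K] ([frobenius_independent]). By the primitive element
    theorem, [F = K(t, y)] for some [y] ([plane_generator]).

    The point [P] may be singular on the curve [f(t, y) = 0], but
    [f_Y(t, y)] is nonzero, say of value [k]. Subtracting from [y] a truncation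
    of its expansion in powers of [t], one may assume that [y] has value greater
    than [k]; then the coefficient of degree 1 of [f] in [Y] is [t ^ k] times
    a unit at [P], and that of degree 0 is divisible by [t ^ (2 k + 1)]
    ([newton_model]). For [a] in [K] of large value, [f(a, Y)] then satisfies
    Newton's criterion [v (f(a, 0)) > 2 v (f_Y(a, 0))], which Hensel's lemma
    for monic polynomials implies ([newton_root]), so that the curve has a point
    [(a, b)] with [f_Y(a, b) <> 0] ([newton_points]).

    At such a point the local ring of the curve is a discrete valuation ring
    with parameter [t - a] and residue field [K], hence defines a rational place
    with [t] sent to [a] ([smooth_point_place]). Its discreteness and that of [P]
    have the same elementary reason: a nonzero element [w] divides a nonzero
    polynomial in [t], namely the constant term of its equation over [K[t]]
    ([unit_times_power]). Infinitely many values of [a] are available, and they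
    give distinct places. *)

Set Implicit Arguments.
Unset Strict Implicit.
Unset Printing Implicit Defensive.
Import Order.TTheory GRing.Theory Num.Theory.
Local Open Scope ring_scope.

(** * Newton's criterion over a henselian valued field *)

Section ValuationRing.

Variables (K : fieldType) (G : porderZmodType) (v : K -> option G).
Hypothesis valv : valuation v.

Definition valint x := ole (Some 0) (v x).
Definition small_elt x := olt (Some 0) (v x).

Local Notation O := valint.
Local Notation M := small_elt.

Let le_total (x y : G) : (x <= y) || (y <= x).
Proof. by case: valv => [[le_tot _] _ _ _]; exact: le_tot. Qed.

Let le_add (x y z : G) : x <= y -> x + z <= y + z.
Proof. by case: valv => [[_ le_addr] _ _ _]; exact: le_addr. Qed.

Let add_ge0 (x y : G) : 0 <= x -> 0 <= y -> 0 <= x + y.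
Proof. by move=> x0 y0; apply: (le_trans y0); rewrite -{1}[y]add0r le_add. Qed.

Lemma val_eq0 x : v x = None <-> x = 0.
Proof. by case: valv. Qed.

Lemma valM x y : v (x * y) = oadd (v x) (v y).
Proof. by case: valv. Qed.

Lemma val_some x : x != 0 -> exists g, v x = Some g.
Proof.
move=> x0; case E: (v x) => [g|]; first by exists g.
by move/val_eq0: E x0 => ->; rewrite eqxx.
Qed.

Lemma val1 : v 1 = Some 0.
Proof.
have [g Eg] := val_some (oner_neq0 K).
have := valM 1 1; rewrite mulr1 Eg /= => -[/eqP].
by rewrite -subr_eq0 opprD addrA subrr sub0r oppr_eq0 => /eqP ->.
Qed.

Lemma val_invr x g : v x = Some g -> v x^-1 = Some (- g).
Proof.
move=> Ex; have x0 : x != 0 by apply/eqP => /val_eq0; rewrite Ex.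
have := valM x x^-1; rewrite mulfV // val1 Ex.
by case: (v x^-1) => //= h [/esym/eqP]; rewrite addrC addr_eq0 => /eqP ->.
Qed.

Lemma smallW x : M x -> O x.
Proof. by case/andP. Qed.

Lemma valint0 : O 0.
Proof. by rewrite /O (_ : v 0 = None) //; apply/val_eq0. Qed.

Lemma small0 : M 0.
Proof. by rewrite /M (_ : v 0 = None) //; apply/val_eq0. Qed.

Lemma valint1 : O 1.
Proof. by rewrite /O val1 /= lexx. Qed.

Lemma small1 : ~~ M 1.
Proof. by rewrite /M /olt val1 eqxx. Qed.

Lemma valintM x y : O x -> O y -> O (x * y).
Proof.
rewrite /O valM; case: (v x) => [g|] //; case: (v y) => [h|] //=.
exact: add_ge0.
Qed.

Lemma smallM x y : M x -> O y -> M (x * y).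
Proof.
move=> Mx Oy; rewrite /M /olt [ole _ _](valintM (smallW Mx) Oy) andbT valM.
move: Mx Oy; rewrite /M /O /olt; case: (v x) => [g|] //; case: (v y) => [h|] //=.
rewrite andbC => /andP[g0 ng0] h0; apply: contra ng0 => /eqP[/esym/eqP].
rewrite addr_eq0 => /eqP gh; apply/eqP; congr Some; apply/le_anti.
by have := le_add (- h) h0; rewrite subrr add0r -gh g0 => ->.
Qed.

Lemma valintN1 : O (-1).
Proof.
have [|g Eg] := @val_some (-1); first by rewrite oppr_eq0 oner_neq0.
have := valM (-1) (-1); rewrite mulrNN mulr1 val1 Eg /= => -[gg].
rewrite /O Eg /=; case/orP: (le_total 0 g) => // g0.
by have := le_add g g0; rewrite add0r -gg.
Qed.

Lemma valintN x : O x -> O (- x).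
Proof. by rewrite -mulN1r; apply: valintM; exact: valintN1. Qed.

Lemma smallN x : M x -> M (- x).
Proof. by rewrite -mulrN1 => Mx; apply: smallM Mx valintN1. Qed.

Lemma valintD x y : O x -> O y -> O (x + y).
Proof.
case: valv => _ _ _ /(_ x y); rewrite /O.
case: (v x) (v y) (v (x + y)) => [a|] [b|] [c|] //= => [/orP[] h a0 b0|h a0 _|h _ b0].
- exact: le_trans a0 h.
- exact: le_trans b0 h.
- by rewrite orbF in h; exact: le_trans a0 h.
- exact: le_trans b0 h.
Qed.

Lemma valint_total x : O x || M x^-1.
Proof.
have [->|x0] := eqVneq x 0; first by rewrite valint0.
have [g Ex] := val_some x0; rewrite /O /M /olt (val_invr Ex) Ex /=.
case: (boolP (0 <= g)) => //= ng0.
have g0 : g <= 0 by case/orP: (le_total 0 g) => // /(negP ng0).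
apply/andP; split.
  by apply: contra ng0 => /eqP[/esym/eqP]; rewrite oppr_eq0 => /eqP ->.
by have := le_add (- g) g0; rewrite subrr add0r.
Qed.

Lemma valintV x : O x -> ~~ M x -> O x^-1.
Proof.
move=> Ox nMx; have := valint_total x^-1.
by rewrite invrK (negPf nMx) orbF.
Qed.

Lemma smallD x y : M x -> M y -> M (x + y).
Proof.
move=> Mx My; have Oxy := valintD (smallW Mx) (smallW My).
apply: contraT => nMxy; have Oi := valintV Oxy nMxy.
have xy0 : x + y != 0 by apply: contraNneq nMxy => ->; exact: small0.
have [x0|x0] := eqVneq x 0; first by rewrite x0 add0r My in nMxy.
have [y0|y0] := eqVneq y 0; first by rewrite y0 addr0 Mx in nMxy.
case/orP: (valint_total (x / y)) => [Oq|/smallW Oq].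
  have E : 1 = y * ((x / y + 1) * (x + y)^-1) by field; rewrite y0 xy0.
  have := small1; rewrite {1}E smallM // valintM // valintD //.
  exact: valint1.
have E : 1 = x * (((x / y)^-1 + 1) * (x + y)^-1) by field; rewrite x0 y0 xy0.
have := small1; rewrite {1}E smallM // valintM // valintD //.
exact: valint1.
Qed.

Lemma unit_near1 x : M x -> [/\ O (1 + x), ~~ M (1 + x) & O (1 + x)^-1].
Proof.
move=> Mx; have O1x : O (1 + x) by rewrite valintD ?valint1 ?smallW.
have nM : ~~ M (1 + x).
  apply: contra small1 => M1x; rewrite -[1](addrK x).
  by apply: smallD => //; apply: smallN.
by split=> //; apply: valintV.
Qed.

Lemma val_unit x : O x -> ~~ M x -> v x = Some 0.
Proof. by rewrite /O /M /olt => ->; rewrite andbT negbK => /eqP. Qed.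

Lemma valintX x n : O x -> O (x ^+ n).
Proof.
by move=> Ox; elim: n => [|n IHn]; rewrite ?valint1 // exprS valintM.
Qed.

Lemma smallX x n : M x -> M (x ^+ n.+1).
Proof. by move=> Mx; rewrite exprS smallM // valintX // smallW. Qed.

Lemma small_powers_inj s i j : s != 0 -> M s -> s ^+ i = s ^+ j -> i = j.
Proof.
move=> s0 Ms; wlog ij : i j / (i <= j)%N.
  by move=> H; case/orP: (leq_total i j) => h E; [|apply: esym]; apply: H.
move=> E; apply/eqP; rewrite eqn_leq ij leqNgt /=; apply/negP => lt_ij.
have := small1; rewrite (_ : 1 = s ^+ (j - i)); last first.
  by rewrite expfB // E mulfV // expf_neq0.
by rewrite -(@prednK (j - i)) ?subn_gt0 // smallX.
Qed.

Lemma valint_sum (I : Type) (r : seq I) (P : pred I) (E : I -> K) :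
  (forall i, P i -> O (E i)) -> O (\sum_(i <- r | P i) E i).
Proof. by move=> h; elim/big_ind: _ => //; [exact: valint0|exact: valintD]. Qed.

Lemma small_sum (I : Type) (r : seq I) (P : pred I) (E : I -> K) :
  (forall i, P i -> M (E i)) -> M (\sum_(i <- r | P i) E i).
Proof. by move=> h; elim/big_ind: _ => //; [exact: small0|exact: smallD]. Qed.

Lemma valintMn x n : O x -> O (x *+ n).
Proof.
by move=> Ox; elim: n => [|n IHn]; rewrite ?valint0 // mulrS valintD.
Qed.

Lemma smallMn x n : M x -> M (x *+ n).
Proof. by move=> Mx; elim: n => [|n IHn]; rewrite ?small0 // mulrS smallD. Qed.

Lemma valint_horner (p : {poly K}) x :
  (forall i, O p`_i) -> O x -> O p.[x].
Proof.
by move=> Op Ox; rewrite horner_coef valint_sum // => i _;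
  rewrite valintM // valintX.
Qed.

Lemma small_horner (p : {poly K}) x :
  (forall i, M p`_i) -> O x -> M p.[x].
Proof.
by move=> Op Ox; rewrite horner_coef small_sum // => i _;
  rewrite smallM // valintX.
Qed.

Lemma common_scale (s : seq K) :
  exists2 c, c != 0 & forall x, x \in s -> O (c * x).
Proof.
elim: s => [|x s [c c0 IH]]; first by exists 1; rewrite ?oner_neq0.
case/boolP: (O (c * x)) => [Ox|nOx].
  by exists c => // y; rewrite in_cons => /predU1P[->|/IH].
have := valint_total (c * x); rewrite (negPf nOx) /= => Mi.
have cx0 : c * x != 0 by apply: contraNneq nOx => ->; exact: valint0.
exists ((c * x)^-1 * c); first by rewrite mulf_neq0 // invr_eq0.
move=> y; rewrite in_cons => /predU1P[->|/IH Oy].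
  by rewrite -mulrA mulVf // valint1.
by rewrite -mulrA valintM // smallW.
Qed.

Lemma exists_small : nontrivial_valuation v -> exists2 s, s != 0 & M s.
Proof.
case=> x x0 vx; case/boolP: (M x) => [Mx|nMx]; first by exists x.
exists x^-1; first by rewrite invr_eq0.
have := valint_total x; case/boolP: (O x) => //= Ox _.
by case: vx; apply: val_unit.
Qed.

Hypothesis hensv : henselian v.

(** Newton's criterion, deduced from Hensel's lemma for monic polynomials.
    If the constant term [q0] vanishes, then 0 is a simple root. Otherwise, with
    [e = q0 / q1 ^ 2] and [n] the degree of [q], the substitution
    [Z = - e * q1 / U] turns [q] into [q0 / U ^ n] times a monic polynomial in
    [U] which is congruent to [U ^ n - U ^ n.-1] modulo the maximal ideal, and
    thus has the simple residual root 1. *)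
Lemma newton_root (q : {poly K}) :
    (forall i, O q`_i) -> q`_1 != 0 -> M (q`_0 / q`_1 ^+ 2) ->
  exists2 b, root q b & q^`().[b] != 0.
Proof.
move=> Oq q1 Me; have [q0|q0] := eqVneq q`_0 0.
  exists 0; first by rewrite rootE horner_coef0 q0.
  by rewrite horner_coef0 coef_deriv.
have [e {}Me q0E] : exists2 e, M e & q`_0 = e * q`_1 ^+ 2.
  by exists (q`_0 / q`_1 ^+ 2); rewrite ?divfK ?expf_neq0.
have [m sz_q] : exists m, size q = m.+2.
  case E: (size q) => [|[|m]]; last by exists m.
    by move: q1; rewrite nth_default ?eqxx // E.
  by move: q1; rewrite nth_default ?eqxx // E.
(* the coefficients of the monic polynomial in degrees less than [n.-1] *)
pose c i : K := (-1) ^+ i.+2 * q`_i.+2 * e ^+ i.+1 * q`_1 ^+ i.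
have Mc i : M (c i).
  have -> : c i = e * (e ^+ i * (q`_1 ^+ i * ((-1) ^+ i.+2 * q`_i.+2))).
    by rewrite /c [e ^+ i.+1]exprS; ring.
  apply: smallM => //; apply: valintM; first exact/valintX/smallW.
  apply: valintM; first exact: valintX.
  by apply: valintM => //; exact/valintX/valintN1.
pose p : {poly K} := \poly_(j < m) c (m.-1 - j)%N.
have Mp i : M p`_i by rewrite coef_poly; case: ifP => _; rewrite ?small0.
pose N : {poly K} := 'X^(m.+1) + (p - 'X^m).
have mon_N : N \is monic.
  rewrite monicE lead_coefDl ?lead_coefXn // size_polyXn ltnS.
  rewrite (leq_trans (size_polyD _ _)) // geq_max size_polyN size_polyXn leqnn.
  by rewrite andbT (leq_trans (size_poly _ _)).
have ON i : O N`_i.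
  have Ob (b : bool) : O b%:R by case: b; rewrite ?valint0 ?valint1.
  by rewrite !coefD coefN !coefXn valintD // valintD ?valintN // smallW.
have N1 : N.[1] = p.[1].
  by rewrite !(hornerD, hornerN, hornerXn) !expr1n addrCA subrr addr0.
have N'1 : N^`().[1] = 1 + p^`().[1].
  rewrite !(derivD, derivN, derivXn) !(hornerD, hornerN, hornerMn, hornerXn).
  by rewrite !expr1n mulrSr; ring.
have Mp'1 : M p^`().[1].
  apply: small_horner valint1 => i; rewrite coef_deriv.
  exact: smallMn.
have [b' /eqP Nb' Mb'] : exists2 u, root N u & M (u - 1).
  apply: hensv => //; first exact: valint1.
    by rewrite N1; apply: small_horner valint1.
  have [O1 nM1 _] := unit_near1 Mp'1.
  by rewrite N'1; apply: val_unit.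
have [] := unit_near1 Mb'; rewrite addrC subrK => Ou nMu Oui.
set u := b' in Nb' Ou nMu Oui.
have u0 : u != 0 by apply: contraNneq nMu => ->; exact: small0.
pose b1 := - (e / u); have Mb1 : M b1 by rewrite smallN // smallM.
exists (q`_1 * b1).
  rewrite rootE horner_coef sz_q.
  suff -> : \sum_(i < m.+2) q`_i * (q`_1 * b1) ^+ i = q`_0 / u ^+ m.+1 * N.[u].
    by rewrite Nb' mulr0.
  rewrite !(hornerD, hornerN, hornerXn) horner_poly.
  rewrite !big_ord_recl /= expr0 mulr1 expr1 /bump /= !add1n.
  rewrite (reindex_inj rev_ord_inj) /=.
  have -> : q`_1 * (q`_1 * b1) = - (q`_0 / u) by rewrite q0E /b1; field.
  rewrite [in RHS]mulrDr [in RHS]mulrBr divfK ?expf_neq0 //; congr (_ + _).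
  rewrite addrC; congr (_ + _); last first.
    by rewrite exprS; field; rewrite u0 expf_neq0.
  rewrite mulr_sumr; apply: eq_bigr => i _; rewrite !add1n.
  case: m i {sz_q p Mp N mon_N ON N1 N'1 Mp'1 Nb'} => [[]//|m i] /=.
  have im : (i <= m)%N by rewrite -ltnS.
  rewrite subSS /c /b1 q0E.
  move: (nat_of_ord i) im => {}i im; rewrite -(subnKC im) addKn.
  move: (m - i)%N => k; rewrite (_ : (i + k).+2 = k + i + 2)%N; last first.
    by rewrite addn2 [(k + i)%N]addnC.
  rewrite -[in LHS]addn2 !exprD !exprMn [(- _) ^+ k]exprNn exprMn exprVn.
  rewrite [(-1) ^+ k.+2]exprS [(-1) ^+ k.+1]exprS [e ^+ k.+1]exprS addn2.
  by field; rewrite u0 !expf_neq0.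
(* at [q1 * b1] the derivative is [q1] up to a factor congruent to 1 *)
pose r := drop_poly 1 q^`().
have qE : q^`() = r * 'X + (q`_1)%:P.
  rewrite -[LHS](poly_take_drop 1) addrC expr1; congr (_ + _).
  by rewrite /take_poly poly_def big_ord1 coef_deriv expr0 alg_polyC.
have Or : O r.[q`_1 * b1].
  apply: valint_horner => [i|]; last exact: valintM (Oq _) (smallW Mb1).
  by rewrite coef_drop_poly coef_deriv valintMn.
have -> : q^`().[q`_1 * b1] = q`_1 * (1 + b1 * r.[q`_1 * b1]).
  by rewrite qE hornerMXaddC; ring.
rewrite mulf_neq0 //; have [_ + _] := unit_near1 (smallM Mb1 Or).
by apply: contraNneq => ->; exact: small0.
Qed.

End ValuationRing.

(** * Preliminaries on polynomials *)

(** The digits of [q] in base ['X^p]. *)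
Lemma poly_base_Xn (R : nzRingType) (q : {poly R}) p M :
  (0 < p)%N -> (size q <= M * p)%N ->
  q = \sum_(j < M) \poly_(l < p) q`_(j * p + l) * 'X^(j * p).
Proof.
move=> p0 sz_q; apply/polyP => m; rewrite coef_sum.
under eq_bigr => j _ do rewrite coefMXn coef_poly.
have [lt_m|le_m] := ltnP m (M * p); last first.
  rewrite nth_default ?(leq_trans sz_q) // big1 // => j _.
  case: ltnP => // le_jm; case: ltnP => // lt_mj.
  suff : (m < m)%N by rewrite ltnn.
  move: lt_mj; rewrite ltn_subLR // -mulSnr => /leq_trans; apply.
  by rewrite (leq_trans _ le_m) // leq_mul2r ltn_ord orbT.
have lt_mp : (m %/ p < M)%N by rewrite ltn_divLR.
rewrite (bigD1 (Ordinal lt_mp)) //= ltnNge leq_divM /= big1 ?addr0 => [|j].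
  by rewrite subnKC ?leq_divM // {2}(divn_eq m p) addKn ltn_mod p0.
rewrite -val_eqE /= => jm; case: ltnP => // le_jm.
case: ltnP => // lt_mj; case/eqP: jm.
rewrite -(subnKC le_jm) divnMDl // divn_small ?addn0 //.
Qed.

Lemma map_poly_inj0 (R S : nzRingType) (g : {rmorphism R -> S}) (f : {poly R}) :
  (forall r, g r = 0 -> r = 0) -> map_poly g f = 0 -> f = 0.
Proof.
move=> g_inj /polyP gf; apply/polyP => i; rewrite coef0; apply: g_inj.
by have := gf i; rewrite coef_map coef0.
Qed.

Lemma injective_avoids_roots (L : fieldType) (a : nat -> L) (r : {poly L}) :
  injective a -> r != 0 -> exists n, ~~ root r (a n).
Proof.
move=> inj_a r0; apply: contrapT => /forallNP all_root.
pose s := mkseq a (size r).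
have := @max_poly_roots _ r s r0; rewrite size_mkseq ltnn => H.
suff : false by []. apply: H; last by rewrite mkseq_uniq.
by apply/allP => _ /mapP[i _ ->]; apply: contrapT => /negP; exact: all_root.
Qed.

(** * Fractions of the image of a ring morphism *)

Definition frac_of (R : Type) (F : fieldType) (theta : R -> F) (w : F) : Prop :=
  exists p q : R, theta q != 0 /\ w = theta p / theta q.

Section FractionsOfImage.

Variables (R : comNzRingType) (F : fieldType) (theta : {rmorphism R -> F}).
Local Notation frac_of := (frac_of theta).

Lemma frac_of_img p : frac_of (theta p).
Proof. by exists p, 1; rewrite rmorph1 oner_neq0 divr1. Qed.

Lemma frac_ofD x y : frac_of x -> frac_of y -> frac_of (x + y).
Proof.
move=> [p [q [q0 ->]]] [r [s [s0 ->]]]; exists (p * s + r * q), (q * s).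
rewrite !(rmorphD, rmorphM) mulf_neq0 //; split=> //.
by field; rewrite ?q0 ?s0.
Qed.

Lemma frac_ofM x y : frac_of x -> frac_of y -> frac_of (x * y).
Proof.
move=> [p [q [q0 ->]]] [r [s [s0 ->]]]; exists (p * r), (q * s).
by rewrite !rmorphM mulf_neq0 //; split=> //; field; rewrite ?q0 ?s0.
Qed.

Lemma frac_ofV x : frac_of x -> frac_of x^-1.
Proof.
move=> [p [q [q0 ->]]]; have [p0|p0] := eqVneq (theta p) 0.
  by rewrite p0 mul0r invr0 -(rmorph0 theta); exact: frac_of_img.
by exists q, p; rewrite invfM invrK mulrC.
Qed.

Lemma frac_of_sum (I : Type) (r : seq I) (P : pred I) (E : I -> F) :
  (forall i, P i -> frac_of (E i)) -> frac_of (\sum_(i <- r | P i) E i).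
Proof.
move=> h; elim/big_ind: _ => //; last exact: frac_ofD.
by rewrite -(rmorph0 theta); exact: frac_of_img.
Qed.

Lemma frac_of_horner (p : {poly F}) x :
  (forall i, frac_of p`_i) -> frac_of x -> frac_of p.[x].
Proof.
elim/poly_ind: p => [|p c IHp] Hp Hx.
  by rewrite horner0 -(rmorph0 theta); exact: frac_of_img.
rewrite hornerMXaddC; apply: frac_ofD; last first.
  by have := Hp 0%N; rewrite coefD coefMX coefC add0r.
apply: frac_ofM => //; apply: IHp => // i.
by have := Hp i.+1; rewrite coefD coefMX coefC addr0.
Qed.

Lemma common_denominator n (w : nat -> F) : (forall i, frac_of (w i)) ->
  exists2 d, theta d != 0 &
  exists c : nat -> R, forall i, (i < n)%N -> theta d * w i = theta (c i).
Proof.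
move=> fw; elim: n => [|n [d d0 [c Ec]]].
  by exists 1; [rewrite rmorph1 oner_neq0 | exists (fun=> 0)].
have [p [q [q0 wn]]] := fw n; exists (d * q).
  by rewrite rmorphM mulf_neq0.
exists (fun i => if (i < n)%N then c i * q else d * p) => i.
rewrite ltnS leq_eqVlt => /predU1P[->|lt_in].
  by rewrite ltnn wn !rmorphM; field.
by rewrite lt_in !rmorphM -Ec //; ring.
Qed.

End FractionsOfImage.

Section FractionField.

Variables (R : idomainType) (F : fieldType) (theta : {rmorphism R -> F}).

Lemma frac_repr (u : {fraction R}) :
  u = tofrac \n_(repr u) / tofrac \d_(repr u).
Proof.
apply/(canRL (mulfK _)); first by rewrite tofrac_eq0 denom_ratioP.
rewrite -{1}[u]reprK; move: (repr u) => x; unlock FracField.tofrac.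
rewrite -[LHS]FracField.pi_mul; apply/eqmodP.
rewrite /= FracField.equivfE /FracField.mulf.
by rewrite !numden_Ratio ?mulf_neq0 ?oner_neq0 ?denom_ratioP // !mulr1 mulrC.
Qed.

Hypothesis theta_inj : forall r, theta r = 0 -> r = 0.

(** The extension of an injective morphism to the field of fractions. The proof
    of injectivity is an argument, so that the morphism structure below can be
    inferred from the term alone. *)
Definition frac_lift of (forall r, theta r = 0 -> r = 0) :=
  fun u : {fraction R} => theta \n_(repr u) / theta \d_(repr u).

Lemma frac_liftE n d : d != 0 ->
  frac_lift theta_inj (tofrac n / tofrac d) = theta n / theta d.
Proof.
move=> d0; set u := _ / _; rewrite /frac_lift.
have th0 r : r != 0 -> theta r != 0 by move=> r0; apply: contra_neq r0 => /theta_inj.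
have d'0 := denom_ratioP (repr u).
apply/eqP; rewrite eqr_div ?th0 // -!rmorphM; apply/eqP; congr (theta _).
apply/eqP; rewrite -tofrac_eq !rmorphM -eqr_div ?tofrac_eq0 //.
by rewrite -frac_repr.
Qed.

Fact frac_lift_is_zmod_morphism : zmod_morphism (frac_lift theta_inj).
Proof.
move=> u w; rewrite (frac_repr u) (frac_repr w).
have := denom_ratioP (repr u); have := denom_ratioP (repr w).
move: (\n_ _) (\d_ _) (\n_ _) (\d_ _) => a b c d b0 d0.
have th0 r : r != 0 -> theta r != 0 by move=> r0; apply: contra_neq r0 => /theta_inj.
rewrite -mulNr -rmorphN addf_div ?tofrac_eq0 // -!rmorphM -rmorphD.
rewrite !frac_liftE ?mulf_neq0 // !(rmorphD, rmorphM, rmorphN) /=.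
by field; rewrite !th0.
Qed.

Fact frac_lift_is_monoid_morphism : monoid_morphism (frac_lift theta_inj).
Proof.
split=> [|u w].
  have := frac_liftE 1 (oner_neq0 R); rewrite !rmorph1 !divr1 => <- //.
rewrite (frac_repr u) (frac_repr w).
have := denom_ratioP (repr u); have := denom_ratioP (repr w).
move: (\n_ _) (\d_ _) (\n_ _) (\d_ _) => a b c d b0 d0.
have th0 r : r != 0 -> theta r != 0 by move=> r0; apply: contra_neq r0 => /theta_inj.
rewrite mulf_div -!rmorphM !frac_liftE ?mulf_neq0 // !rmorphM /=.
by field; rewrite !th0.
Qed.

HB.instance Definition _ := GRing.isZmodMorphism.Build {fraction R} F
  (frac_lift theta_inj) frac_lift_is_zmod_morphism.
HB.instance Definition _ := GRing.isMonoidMorphism.Build {fraction R} F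
  (frac_lift theta_inj) frac_lift_is_monoid_morphism.

Lemma frac_lift_tofrac r : frac_lift theta_inj (tofrac r) = theta r.
Proof.
by have := frac_liftE r (oner_neq0 R); rewrite !rmorph1 !divr1.
Qed.

Lemma frac_of_lift u : frac_of theta (frac_lift theta_inj u).
Proof.
exists \n_(repr u), \d_(repr u); split=> //.
by apply: contra_neq (denom_ratioP (repr u)) => /theta_inj.
Qed.

End FractionField.

Lemma clear_denominators (R : idomainType) (q : {poly {fraction R}}) :
  exists2 d : R, d != 0 &
  exists f : {poly R}, map_poly (@tofrac R) f = tofrac d *: q.
Proof.
elim/poly_ind: q => [|q c [d d0 [f Ef]]].
  by exists 1; rewrite ?oner_neq0 //; exists 0; rewrite rmorph0 scaler0.
rewrite (frac_repr c); have := denom_ratioP (repr c).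
move: (\n_ _) (\d_ _) => a b b0; exists (d * b); first by rewrite mulf_neq0.
exists (b *: f * 'X + (d * a)%:P).
rewrite rmorphD rmorphM /= map_polyX map_polyC map_polyZ /= Ef.
rewrite -!mul_polyC !rmorphM /= mulrDr; congr (_ + _); first by rewrite -!mulrA mulrCA.
rewrite -!polyCM; congr (_%:P).
by rewrite mulrACA mulrA mulfK ?tofrac_eq0.
Qed.

Lemma tofrac_inj0 (R : idomainType) (r : R) : tofrac r = 0 -> r = 0.
Proof. by move/eqP; rewrite tofrac_eq0 => /eqP. Qed.

Lemma size_map_tofrac (R : idomainType) (f : {poly R}) : size (map_poly (@tofrac _) f) = size f.
Proof.
apply: size_map_inj_poly; last exact: rmorph0.
by move=> p q /eqP; rewrite tofrac_eq => /eqP.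
Qed.

(** * Polynomials evaluated in an extension field *)

Section Evaluation.

Variables (K F : fieldType) (iota : {rmorphism K -> F}).

Definition ev (t : F) : {poly K} -> F := horner_morph (fun c => mulrC t (iota c)).
HB.instance Definition _ t := GRing.RMorphism.on (ev t).

(** A point [(t, y)] of the plane has its first coordinate assigned to the inner
    variable, so that the curve is seen as a covering of the line of [t]. *)
Definition ev2 (t y : F) : {poly {poly K}} -> F :=
  horner_morph (fun p => mulrC y (ev t p)).
HB.instance Definition _ t y := GRing.RMorphism.on (ev2 t y).

Lemma evE t p : ev t p = (map_poly iota p).[t]. Proof. by []. Qed.
Lemma evC t c : ev t c%:P = iota c. Proof. exact: horner_morphC. Qed.
Lemma evX t : ev t 'X = t. Proof. exact: horner_morphX. Qed.
Lemma ev2E t y f : ev2 t y f = (map_poly (ev t) f).[y]. Proof. by []. Qed.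
Lemma ev2C t y p : ev2 t y p%:P = ev t p. Proof. exact: horner_morphC. Qed.
Lemma ev2X t y : ev2 t y 'X = y. Proof. exact: horner_morphX. Qed.

Lemma ev_poly t n (E : nat -> K) :
  ev t (\poly_(i < n) E i) = \sum_(i < n) iota (E i) * t ^+ i.
Proof.
rewrite poly_def rmorph_sum; apply: eq_bigr => i _.
by rewrite -mul_polyC rmorphM rmorphXn /= evC evX.
Qed.

Lemma ev2_poly t y n (E : nat -> {poly K}) :
  ev2 t y (\poly_(i < n) E i) = \sum_(i < n) ev t (E i) * y ^+ i.
Proof.
rewrite poly_def rmorph_sum; apply: eq_bigr => i _.
by rewrite -mul_polyC rmorphM rmorphXn /= ev2C ev2X.
Qed.

Lemma ev2_comp t y (f g : {poly {poly K}}) :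
  ev2 t y (f \Po g) = ev2 t (ev2 t y g) f.
Proof. by rewrite ev2E map_comp_poly horner_comp. Qed.

Lemma ev2_shift t y p f :
  ev2 t y (f \Po ('X + p%:P)) = ev2 t (y + ev t p) f.
Proof. by rewrite ev2_comp rmorphD /= ev2X ev2C. Qed.

Lemma ev2_swap t y (f : {poly {poly K}}) : ev2 y t (swapXY f) = ev2 t y f.
Proof.
elim/poly_ind: f => [|f c IHf]; first by rewrite !rmorph0.
rewrite rmorphD rmorphM /= swapXY_X swapXY_polyC !rmorphD !rmorphM /= IHf.
rewrite ev2C ev2X ev2C evX; congr (_ + _).
by rewrite ev2E -map_poly_comp evE; congr (_.[_]);
  apply: eq_map_poly => a /=; rewrite evC.
Qed.

Lemma frac_of_ev t p : frac_of (ev t) (ev t p).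
Proof. exact: (@frac_of_img {poly K} F (ev t)). Qed.

Lemma frac_of_ev2 t y f : frac_of (ev2 t y) (ev2 t y f).
Proof. exact: (@frac_of_img {poly {poly K}} F (ev2 t y)). Qed.

Lemma frac_of_gen t y : frac_of (ev2 t y) y.
Proof. by rewrite -[X in frac_of _ X](ev2X t y); exact: frac_of_ev2. Qed.

Lemma frac_of_ev_ev2 t y w : frac_of (ev t) w -> frac_of (ev2 t y) w.
Proof.
by move=> [n [d [d0 ->]]]; exists n%:P, d%:P; rewrite !ev2C.
Qed.

Definition transcendental t := forall p, ev t p = 0 -> p = 0.

(** [algebraic_over t w] says that [w] is algebraic over [K(t)], with the
    denominators of the equation cleared. *)
Definition algebraic_over t w :=
  exists2 f : {poly {poly K}}, f != 0 & ev2 t w f = 0.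

Definition annihilator_degree_le t y (f : {poly {poly K}}) :=
  forall g, ev2 t y g = 0 -> g != 0 -> (size f <= size g)%N.

Lemma minimal_annihilator t y : algebraic_over t y ->
  exists f, [/\ f != 0, ev2 t y f = 0 & annihilator_degree_le t y f].
Proof.
move=> [f0 f00 f0y].
have Pex : exists n, `[< exists f, [/\ f != 0, ev2 t y f = 0 & size f = n] >].
  by exists (size f0); apply/asboolP; exists f0.
case: (ex_minnP Pex) => n /asboolP[f [f_neq0 fy <-]] fmin.
by exists f; split=> // g gy g0; apply: fmin; apply/asboolP; exists g.
Qed.

End Evaluation.

(** * Local rings with residue field K *)

Section LocalMap.

Variables (K F : fieldType) (iota : {rmorphism K -> F}).
Implicit Types (P : F -> option K).

(** [P] is the residue map of a local ring which contains [K], lies in [F] and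
    has residue field [K]; the ring is the set where [P] is defined. A rational
    place is the case of a valuation ring. *)
Definition local_map P :=
  [/\ forall c, P (iota c) = Some c,
      forall x y a b, P x = Some a -> P y = Some b -> P (x + y) = Some (a + b),
      forall x y a b, P x = Some a -> P y = Some b -> P (x * y) = Some (a * b)
    & forall x a, P x = Some a -> a != 0 -> P x^-1 = Some a^-1].

Section Theory.

Variable P : F -> option K.
Hypothesis lP : local_map P.

Lemma local_const c : P (iota c) = Some c. Proof. by case: lP. Qed.
Lemma local_add x y a b : P x = Some a -> P y = Some b -> P (x + y) = Some (a + b).
Proof. by case: lP => _ h _ _; exact: h. Qed.
Lemma local_mul x y a b : P x = Some a -> P y = Some b -> P (x * y) = Some (a * b).
Proof. by case: lP => _ _ h _; exact: h. Qed.
Lemma local_inv x a : P x = Some a -> a != 0 -> P x^-1 = Some a^-1.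
Proof. by case: lP => _ _ _ h; exact: h. Qed.

Lemma local0 : P 0 = Some 0. Proof. by rewrite -(rmorph0 iota) local_const. Qed.
Lemma local1 : P 1 = Some 1. Proof. by rewrite -(rmorph1 iota) local_const. Qed.

Lemma local_opp x a : P x = Some a -> P (- x) = Some (- a).
Proof.
move=> Px; rewrite -mulN1r -(rmorph1 iota) -rmorphN -[- a]mulN1r.
exact: local_mul (local_const _) Px.
Qed.

Lemma local_sub x y a b : P x = Some a -> P y = Some b -> P (x - y) = Some (a - b).
Proof. by move=> Px /local_opp; exact: local_add. Qed.

Lemma local_exp x a n : P x = Some a -> P (x ^+ n) = Some (a ^+ n).
Proof.
move=> Px; elim: n => [|n IHn]; first exact: local1.
by rewrite !exprS; exact: local_mul.
Qed.

Lemma local_neq0 x a : P x = Some a -> a != 0 -> x != 0.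
Proof.
by move=> Px; apply: contra_neq => x0; move: Px; rewrite x0 local0 => -[].
Qed.

Lemma local_ev t a p : P t = Some a -> P (ev iota t p) = Some p.[a].
Proof.
move=> Pt; elim/poly_ind: p => [|p c IHp]; first by rewrite rmorph0 horner0 local0.
rewrite rmorphD rmorphM /= evX evC hornerMXaddC.
by apply: local_add (local_const _); exact: local_mul.
Qed.

Lemma local_ev2 t y a b f : P t = Some a -> P y = Some b ->
  P (ev2 iota t y f) = Some f.[b%:P].[a].
Proof.
move=> Pt Py; elim/poly_ind: f => [|f c IHf].
  by rewrite rmorph0 !horner0 local0.
rewrite rmorphD rmorphM /= ev2X ev2C hornerMXaddC hornerD hornerM hornerC.
by apply: local_add; [exact: local_mul | exact: local_ev].
Qed.

Lemma local_sum (I : Type) (r : seq I) (Q : pred I) (E : I -> F) :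
  (forall i, Q i -> exists a, P (E i) = Some a) ->
  exists a, P (\sum_(i <- r | Q i) E i) = Some a.
Proof.
move=> h; elim/big_ind: _ => // [|x y [a Ha] [b Hb]]; first by exists 0; exact: local0.
by exists (a + b); exact: local_add.
Qed.

Lemma local_sum0 (I : Type) (r : seq I) (Q : pred I) (E : I -> F) :
  (forall i, Q i -> P (E i) = Some 0) -> P (\sum_(i <- r | Q i) E i) = Some 0.
Proof.
move=> h; elim/big_ind: _ => // [|x y Px Py]; first exact: local0.
by rewrite -[0]addr0; exact: local_add.
Qed.

(** Since [x / pi] is in the ring for every [x] of residue 0, the maximal ideal
    is generated by [pi]. *)
Definition uniformizer pi :=
  P pi = Some 0 /\ forall x, P x = Some 0 -> exists a, P (x / pi) = Some a.

(** Iterating the division by [pi] on a nonzero [w] stops: [w] satisfies a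
    polynomial equation over [K[t]] with nonzero constant term, which is a
    multiple of [w] and, as a polynomial in [t], a power of [pi = t - a] times
    a unit. *)
Lemma unit_times_power t a w b :
    P t = Some a -> uniformizer (t - iota a) -> transcendental iota t ->
    algebraic_over iota t w -> w != 0 -> P w = Some b ->
  exists k u c, [/\ c != 0, P u = Some c & w = u * (t - iota a) ^+ k].
Proof.
move=> Pt [Ppi unif] tr_t [f f0 fw] w0 Pw; set pi := t - iota a in Ppi unif *.
have pi0 : pi != 0.
  rewrite /pi -(evX iota t) -(evC iota t) -rmorphB.
  by apply/eqP => /tr_t/eqP; rewrite polyXsubC_eq0.
(* dividing by the variable gives the equation a nonzero constant term [c] *)
have [m [r [br [U [cU [cU0 PU Pr wr]]]]]] : exists m r br U cU,
    [/\ cU != 0, P U = Some cU, P r = Some br & w * r = U * pi ^+ m].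
  elim/poly_ind: f f0 fw => [|f c IHf]; first by rewrite eqxx.
  have [->|c0] := eqVneq c 0.
    rewrite addr0 mulf_eq0 polyX_eq0 orbF => f0.
    by rewrite rmorphM /= ev2X => /eqP; rewrite mulf_eq0 (negPf w0) orbF => /eqP; exact: IHf.
  move=> _; rewrite rmorphD rmorphM /= ev2X ev2C => /eqP.
  rewrite addrC addr_eq0 -mulNr => /eqP cw.
  have [m [q]] := multiplicity_XsubC c a; rewrite c0 /= => qa cE.
  exists m, (- ev2 iota t w f), (- f.[b%:P].[a]), (ev iota t q), q.[a].
  split=> //; [exact: local_ev | exact/local_opp/local_ev2 |].
  by rewrite mulrC -cw cE rmorphM rmorphXn rmorphB /= evX evC.
elim: m w b {f f0 fw} w0 Pw wr => [|m IHm] w b w0 Pw wr.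
  have [b0|b0] := eqVneq b 0; last by exists 0%N, w, b; rewrite mulr1.
  have := local_mul Pw Pr; rewrite wr b0 mul0r mulr1 PU => -[/eqP].
  by rewrite (negPf cU0).
have [b0|b0] := eqVneq b 0; last by exists 0%N, w, b; rewrite mulr1.
rewrite b0 in Pw; have [b1 Pw1] := unif w Pw.
have [||k [u [c [c0 Pu wE]]]] := IHm _ _ _ Pw1.
- by rewrite mulf_neq0 // invr_eq0.
- by rewrite mulrAC wr exprSr mulrA mulfK.
exists k.+1, u, c; split=> //.
by rewrite exprSr mulrA -wE divfK.
Qed.

(** Both terms of a fraction are powers of the uniformizer up to units, so the
    fraction or its inverse lies in the ring. *)
Lemma rational_place_of_local t a :
    P t = Some a -> uniformizer (t - iota a) -> transcendental iota t ->
    (forall w, algebraic_over iota t w) ->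
    (forall w, exists x y b c, [/\ P x = Some b, P y = Some c & w = x / y]) ->
  rational_place iota P.
Proof.
move=> Pt unif tr_t alg gen; split; last exact: local_const.
split; [exact: local1|exact: local_add|exact: local_mul|] => w Pw.
have [x [y [b [c [Px Py wE]]]]] := gen w.
have [x0|x0] := eqVneq x 0.
  by move: Pw; rewrite wE x0 mul0r local0.
have [y0|y0] := eqVneq y 0.
  by move: Pw; rewrite wE y0 invr0 mulr0 local0.
have [k [u [d [d0 Pu xE]]]] := unit_times_power Pt unif tr_t (alg x) x0 Px.
have [l [v [e [e0 Pv yE]]]] := unit_times_power Pt unif tr_t (alg y) y0 Py.
set pi := t - iota a in unif xE yE; have Ppi : P pi = Some 0 by case: unif.
have u0 := local_neq0 Pu d0; have v0 := local_neq0 Pv e0.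
have pi0 : pi != 0.
  rewrite /pi -(evX iota t) -(evC iota t) -rmorphB.
  by apply/eqP => /tr_t/eqP; rewrite polyXsubC_eq0.
case: (leqP l k) => [lk|kl].
  have wE' : w = u * v^-1 * pi ^+ (k - l).
    rewrite wE xE yE -{1}(subnK lk) exprD; field.
    by rewrite v0 expf_neq0.
  have := local_mul (local_mul Pu (local_inv Pv e0)) (local_exp (k - l) Ppi).
  by rewrite -wE' Pw.
have wE' : w^-1 = v * u^-1 * pi ^+ (l - k).
  rewrite wE xE yE -{1}(subnK (ltnW kl)) exprD; field.
  by rewrite u0 v0 !expf_neq0.
have := local_mul (local_mul Pv (local_inv Pu d0)) (local_exp (l - k) Ppi).
by rewrite -wE' -(@prednK (l - k)) ?subn_gt0 // exprS mul0r mulr0.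
Qed.

End Theory.

Lemma place_local P : rational_place iota P -> local_map P.
Proof.
move=> [[P1 PD PM PV] Pc]; split=> // x a Px a0.
have x0 : x != 0.
  by apply: contra_neq a0 => x0; move: Px; rewrite x0 -(rmorph0 iota) Pc => -[].
case E: (P x^-1) => [b|]; last first.
  by have := PV _ E; rewrite invrK Px => -[/eqP]; rewrite (negPf a0).
have := PM _ _ _ _ Px E; rewrite mulfV // P1 => -[ab].
by congr Some; rewrite -[b]mul1r -(mulVf a0) -mulrA -ab mulr1.
Qed.

End LocalMap.

(** * The place of a smooth point of a plane curve *)

Section SmoothPoint.

Variables (K F : fieldType) (iota : {rmorphism K -> F}).
Variables (t y : F) (f : {poly {poly K}}) (a b : K).

Local Notation "p .[@ a , b ]" := (p.[b%:P].[a])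
  (at level 2, left associativity, format "p .[@  a ,  b ]") : ring_scope.

Hypothesis tr_t : transcendental iota t.
Hypothesis alg_t : forall w, algebraic_over iota t w.
Hypothesis gen_y : forall w, frac_of (ev2 iota t y) w.
Hypothesis fy : ev2 iota t y f = 0.
Hypothesis fmin : annihilator_degree_le iota t y f.
Hypothesis fab : f.[@a, b] = 0.
Hypothesis f'ab : f^`().[@a, b] != 0.
Hypothesis lfa : (lead_coef f).[a] != 0.

(** Pseudo-division by [f] shows that a relation between [t] and [y] holds at
    every point of the curve where the leading coefficient of [f] does not
    vanish. *)
Lemma relation_at_point p : ev2 iota t y p = 0 -> p.[@a, b] = 0.
Proof.
move=> py; have f0 : f != 0.
  by apply: contraNneq lfa => ->; rewrite lead_coef0 horner0.
have E := Pdiv.Idomain.divp_eq p f.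
have r0 : p %% f = 0.
  apply/eqP; apply: contraT => r0.
  have ry : ev2 iota t y (p %% f) = 0.
    have /eqP := congr1 (ev2 iota t y) E.
    rewrite -mul_polyC rmorphM rmorphD rmorphM /= py fy !mulr0 add0r.
    by move/eqP.
  by have := fmin ry r0; rewrite leqNgt ltn_modp f0.
have := congr1 (fun g : {poly {poly K}} => g.[@a, b]) E.
rewrite r0 addr0 -mul_polyC !hornerE fab mulr0 => /eqP.
by rewrite mulf_eq0 expf_eq0 (negPf lfa) andbF => /eqP.
Qed.

Definition point_eval w c := exists p q,
  [/\ q.[@a, b] != 0, w = ev2 iota t y p / ev2 iota t y q
    & c = p.[@a, b] / q.[@a, b]].

Let ev_neq0 q : q.[@a, b] != 0 -> ev2 iota t y q != 0.
Proof. by apply: contra_neq => /relation_at_point. Qed.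

Lemma point_eval_fun w c d : point_eval w c -> point_eval w d -> c = d.
Proof.
move=> [p [q [q0 -> ->]]] [r [s [s0 /eqP + ->]]].
rewrite eqr_div ?ev_neq0 // -!rmorphM -subr_eq0 -rmorphB.
move/eqP/relation_at_point/eqP; rewrite !hornerE subr_eq0 => /eqP E.
by apply/eqP; rewrite eqr_div // E.
Qed.

Definition point_map w : option K :=
  match pselect (exists c, point_eval w c) with
  | left h => Some (projT1 (cid h))
  | right _ => None
  end.

Lemma point_mapP w c : point_map w = Some c <-> point_eval w c.
Proof.
rewrite /point_map; case: pselect => h; last by split=> // wc; case: h; exists c.
case: (cid h) => /= d wd; split=> [[<-//]|wc].
by rewrite (point_eval_fun wc wd).
Qed.

Lemma point_map_ev2 p : point_map (ev2 iota t y p) = Some p.[@a, b].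
Proof.
by apply/point_mapP; exists p, 1; rewrite rmorph1 !hornerC !divr1 oner_neq0.
Qed.

Lemma local_point_map : local_map iota point_map.
Proof.
split=> [c|x z c d|x z c d|x c].
- by rewrite -(evC iota t) -(ev2C iota t y) point_map_ev2 !hornerC.
- move=> /point_mapP[p [q [q0 -> ->]]] /point_mapP[r [s [s0 -> ->]]].
  apply/point_mapP; exists (p * s + r * q), (q * s).
  by rewrite !hornerE mulf_neq0 // !(rmorphD, rmorphM) /= !addf_div ?ev_neq0.
- move=> /point_mapP[p [q [q0 -> ->]]] /point_mapP[r [s [s0 -> ->]]].
  apply/point_mapP; exists (p * r), (q * s).
  by rewrite !hornerE mulf_neq0 // !rmorphM /= -!(mulrA (_ / _)) !mulf_div.
- move=> /point_mapP[p [q [q0 -> ->]]]; rewrite mulf_eq0 negb_or => /andP[p0 _].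
  by apply/point_mapP; exists q, p; rewrite !invf_div.
Qed.

Lemma poly_at_point (p : {poly K}) : exists q, p = q * ('X - a%:P) + p.[a]%:P.
Proof.
have /factor_theorem[q E] : root (p - p.[a]%:P) a by rewrite rootE !hornerE subrr.
by exists q; rewrite -E subrK.
Qed.

Lemma poly2_at_point (p : {poly {poly K}}) : exists w u : _,
  p = w * ('X - b%:P%:P) + u%:P * ('X - a%:P)%:P + p.[@a, b]%:P%:P.
Proof.
have /factor_theorem[w E] : root (p - p.[b%:P]%:P) b%:P.
  by rewrite rootE !hornerE subrr.
have [u Eu] := poly_at_point p.[b%:P].
by exists w, u; rewrite -polyCM -addrA -polyCD -Eu -E subrK.
Qed.

(** The function [t - a] is a local parameter: expanding [f] at the point
    expresses [y - b] as a multiple of [t - a], with the nonvanishing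
    derivative in the denominator. *)
Lemma point_uniformizer : uniformizer point_map (t - iota a).
Proof.
have Pt : point_map t = Some a.
  by rewrite -[t in LHS](evX iota) -(ev2C iota t y) point_map_ev2 hornerC hornerX.
have lP := local_point_map.
have pi0 : t - iota a != 0.
  rewrite -(evX iota t) -(evC iota t) -rmorphB.
  by apply/eqP => /tr_t/eqP; rewrite polyXsubC_eq0.
have evpi : ev2 iota t y ('X - a%:P)%:P = t - iota a.
  by rewrite ev2C rmorphB /= evX evC.
split; first by have := local_sub lP Pt (local_const lP a); rewrite subrr.
have [h Ph] : exists h, point_map ((y - iota b) / (t - iota a)) = Some h.
  have [w [u E]] := poly2_at_point f; rewrite fab !polyC0 addr0 in E.
  have wab : w.[@a, b] != 0.
    move: f'ab; rewrite E !derivE !hornerE /= subrr.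
    by rewrite mulr0 add0r.
  exists ((- u%:P).[@a, b] / w.[@a, b]); apply/point_mapP; exists (- u%:P), w; split=> //.
  have := congr1 (ev2 iota t y) E.
  rewrite fy rmorphD !rmorphM rmorphB /= ev2X evpi ev2C evC.
  move/esym/eqP; rewrite addr_eq0 => /eqP E1; rewrite (@rmorphN {poly {poly K}} F (ev2 iota t y)).
  apply/eqP; rewrite eqr_div ?ev_neq0 // mulrC E1.
  by rewrite mulNr.
move=> x /point_mapP[p [q [q0 ->]]] /esym/eqP.
rewrite mulf_eq0 invr_eq0 (negPf q0) orbF => /eqP pab.
have [w [u E]] := poly2_at_point p; rewrite pab !polyC0 addr0 in E.
rewrite E rmorphD !rmorphM rmorphB /= ev2X evpi !ev2C evC.
have -> : (ev2 iota t y w * (y - iota b) + ev iota t u * (t - iota a)) /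
    ev2 iota t y q / (t - iota a) =
    (ev2 iota t y w * ((y - iota b) / (t - iota a)) + ev2 iota t y u%:P) *
      (ev2 iota t y q)^-1.
  by rewrite ev2C; field; rewrite pi0 ev_neq0.
eexists; apply: (local_mul lP).
  apply: (local_add lP); last exact: point_map_ev2.
  by apply: (local_mul lP); [exact: point_map_ev2 | exact: Ph].
by apply: (local_inv lP) q0; exact: point_map_ev2.
Qed.

(** The local ring of the curve [f] at a smooth point is a discrete valuation
    ring, so that evaluation at the point is a rational place. *)
Lemma smooth_point_place : exists2 P, rational_place iota P & P t = Some a.
Proof.
have Pt : point_map t = Some a.
  by rewrite -[t in LHS](evX iota) -(ev2C iota t y) point_map_ev2 hornerC hornerX.
exists point_map => //.
apply: (rational_place_of_local local_point_map Pt point_uniformizer tr_t alg_t).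
move=> w; have [p [q [q0 ->]]] := gen_y w.
exists (ev2 iota t y p), (ev2 iota t y q), p.[@a, b], q.[@a, b].
by rewrite !point_map_ev2.
Qed.

End SmoothPoint.

(** * Uniformizers of a rational place *)

Section FunctionFieldPlace.

Variables (K F : fieldType) (iota : {rmorphism K -> F}) (P : F -> option K).
Hypothesis placeP : rational_place iota P.

Let lP : local_map iota P. Proof. exact: place_local. Qed.

(** A nonzero polynomial in [x] is a power of [x] times a polynomial which does
    not vanish at 0, hence times a unit at the place. *)
Lemma transcendental_of_zero x : P x = Some 0 -> x != 0 -> transcendental iota x.
Proof.
move=> Px x0 p px; apply/eqP; apply: contraT => p0.
have [m [q]] := multiplicity_XsubC p 0; rewrite p0 subr0 /= => q0 pE.
move/eqP: px; rewrite pE rmorphM rmorphXn /= evX mulf_eq0.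
rewrite [_ ^+ _ == _]expf_eq0 (negPf x0) andbF orbF => /eqP qx.
have := local_ev lP q Px; rewrite qx (local0 lP) => -[/esym/eqP].
by rewrite -rootE (negPf q0).
Qed.

Definition spans_over x (e : seq F) := forall w, exists c : nat -> F,
  (forall i, frac_of (ev iota x) (c i)) /\ w = \sum_(i < size e) c i * e`_i.

(** The given transcendental element is moved to a zero of the place, by
    subtracting its residue or, at a pole, by inverting it. *)
Lemma zero_spans_over : function_field_one_var iota ->
  exists x e, [/\ P x = Some 0, x != 0 & spans_over x e].
Proof.
move=> [t [tr_t [e fin_e]]].
suff [x [Px x0 tx]] : exists x, [/\ P x = Some 0, x != 0 & frac_of (ev iota x) t].
  exists x, e; split=> // w; have [c [Hc ->]] := fin_e w; exists c; split=> // i.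
  have [p [q [q0 ->]]] := Hc i.
  have fp r : frac_of (ev iota x) (map_poly iota r).[t].
    apply: frac_of_horner => // j; rewrite coef_map /= -(evC iota x).
    exact: frac_of_ev.
  by apply: frac_ofM => //; apply: frac_ofV.
case Pt : (P t) => [c|].
  exists (t - iota c); split.
  - by have := local_sub lP Pt (local_const lP c); rewrite subrr.
  - rewrite subr_eq0; apply: contra_not_neq tr_t => ->; exact: algebraic_id.
  - set u := t - iota c; have -> : t = ev iota u 'X + ev iota u c%:P.
      by rewrite evX evC subrK.
    by apply: frac_ofD; exact: frac_of_ev.
exists t^-1; split; first by case: placeP => [[_ _ _ PV] _]; exact: PV.
  rewrite invr_eq0; apply: contra_eq_neq Pt => ->; rewrite (local0 lP) //.
have tE : t = (ev iota t^-1 'X)^-1 by rewrite evX invrK.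
by rewrite [X in frac_of _ X]tE; apply/frac_ofV/frac_of_ev.
Qed.

Section FiniteOver.

Variables (x : F) (e : seq F).
Hypotheses (Px : P x = Some 0) (x0 : x != 0) (fin_e : spans_over x e).

Let tr_x : transcendental iota x. Proof. exact: transcendental_of_zero. Qed.

(** After clearing denominators the coordinates of the [w i] form a matrix with
    one column less than rows; it is completed by a zero column, so that its
    determinant vanishes. *)
Lemma dependent_over (w : 'I_(size e).+1 -> F) :
  exists2 c : 'I_(size e).+1 -> {poly K}, exists i, c i != 0
  & \sum_i ev iota x (c i) * w i = 0.
Proof.
set n := size e in w *.
have /choice[d Hd] : forall i, exists dc : {poly K} * (nat -> {poly K}),
    dc.1 != 0 /\ ev iota x dc.1 * w i = \sum_(j < n) ev iota x (dc.2 j) * e`_j.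
  move=> i; have [c [Hc wE]] := fin_e (w i).
  have [d d0 [c' Hc']] := common_denominator n Hc.
  exists (d, c'); split; first by apply: contra_neq d0 => /= ->; rewrite rmorph0.
  rewrite wE mulr_sumr; apply: eq_bigr => j _ /=.
  by rewrite mulrA Hc'.
pose A : 'M[{poly K}]_n.+1 := \matrix_(i, j) if (j < n)%N then (d i).2 j else 0.
have /det0P[v v0 vA] : \det A == 0.
  rewrite (expand_det_col A ord_max) big1 // => i _.
  by rewrite mxE /= ltnn mul0r.
exists (fun i => v 0 i * (d i).1).
  have /existsP[i vi] : [exists i, v 0 i != 0].
    apply: contraT; rewrite negb_exists => /forallP v00; case/eqP: v0.
    by apply/rowP => i; rewrite mxE; apply/eqP; have := v00 i; rewrite negbK.
  by exists i; rewrite mulf_neq0 //; case: (Hd i).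
transitivity (\sum_(j < n.+1) ev iota x ((v *m A) 0 j) * e`_j); last first.
  by rewrite big1 // => j _; rewrite vA mxE rmorph0 mul0r.
under [RHS]eq_bigr => j _ do rewrite mxE rmorph_sum mulr_suml.
rewrite exchange_big /=; apply: eq_bigr => i _.
rewrite rmorphM -mulrA (proj2 (Hd i)) mulr_sumr big_ord_recr /= mxE ltnn.
rewrite mulr0 rmorph0 mul0r addr0; apply: eq_bigr => j _.
by rewrite mxE /= ltn_ord rmorphM mulrA.
Qed.

(** A relation whose coefficients are all divisible by [x] can be divided by
    [x], which lowers the degree of a chosen nonzero coefficient. *)
Lemma dependent_mod_x (w : 'I_(size e).+1 -> F) :
  exists2 c : 'I_(size e).+1 -> {poly K}, exists i, (c i).[0] != 0
  & \sum_i ev iota x (c i) * w i = 0.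
Proof.
have [c [i0 ci0] wc] := dependent_over w.
have [n] := ubnP (size (c i0)); elim: n => // n IHn in c ci0 wc * => sz_c.
have [[i ci]|/forallNP c0] := pselect (exists i, (c i).[0] != 0).
  by exists c => //; exists i.
have cE i : c i = drop_poly 1 (c i) * 'X.
  have /negP := c0 i; rewrite negbK horner_coef0 => /eqP ci.
  rewrite -[LHS](poly_take_drop 1) expr1 -[RHS]add0r; congr (_ + _).
  by rewrite /take_poly poly_def big_ord1 ci scale0r.
apply: (IHn (fun i => drop_poly 1 (c i))).
- by apply: contraNneq ci0 => c'0; rewrite cE c'0 mul0r.
- apply: (mulfI x0); rewrite mulr0 -[RHS]wc mulr_sumr; apply: eq_bigr => i _.
  by rewrite [in RHS]cE rmorphM /= evX mulrCA mulrA.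
- rewrite size_drop_poly; apply: (@leq_trans (size (c i0))); last exact: sz_c.
  by rewrite ltn_subrL size_poly_gt0 ci0.
Qed.

Lemma algebraic_of_spans_over w : algebraic_over iota x w.
Proof.
have [c [i ci] wc] := dependent_over (fun i => w ^+ i).
exists (\poly_(i < (size e).+1) c (inord i)).
  apply/eqP => /polyP/(_ i); rewrite coef_poly ltn_ord coef0 inord_val => ci0.
  by rewrite ci0 eqxx in ci.
rewrite ev2_poly -[RHS]wc; apply: eq_bigr => j _.
by rewrite inord_val.
Qed.

(** If the maximal ideal had no generator, there would be [z_0 = x], [z_1],
    [z_2], ... in it with every [z_i / z_(i+1)] in it. A relation between
    [size e + 1] of these with coefficients in [K[x]], not all divisible by
    [x], has exactly one term of lowest value: the one with the largest index
    among the coefficients which do not vanish at 0. *)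
Lemma uniformizer_exists : exists2 t, t != 0 & uniformizer P t.
Proof.
apply: contrapT => no_unif.
have next t : exists z, P t = Some 0 -> t != 0 ->
    [/\ P z = Some 0, z != 0 & P (t / z) = Some 0].
  have [[Pt t0]|h] := pselect (P t = Some 0 /\ t != 0); last first.
    by exists t => Pt t0; case: h.
  have [z [Pz Pzt]] : exists z, P z = Some 0 /\ P (z / t) = None.
    apply: contrapT => h; apply: no_unif; exists t => //; split=> // z Pz.
    case E: (P (z / t)) => [a|]; first by exists a.
    by case: h; exists z.
  have z0 : z != 0 by apply: contra_eq_neq Pzt => ->; rewrite mul0r (local0 lP).
  exists z => _ _; split=> //; rewrite -invf_div.
  by case: placeP => [[_ _ _ PV] _]; exact: PV.
have [nx Hnx] := choice next.
pose z n := iter n nx x.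
have Hz n : P (z n) = Some 0 /\ z n != 0.
  by elim: n => [//|n [Pz z0]]; have [] := Hnx _ Pz z0.
have z_neq0 n : z n != 0 by case: (Hz n).
have zlt i j : (i < j)%N -> P (z i / z j) = Some 0.
  elim: j => // j IHj; rewrite ltnS leq_eqVlt.
  have [_ _ Hj] := Hnx _ (proj1 (Hz j)) (z_neq0 j).
  case/predU1P=> [-> //|/IHj Hij].
  have -> : z i / z j.+1 = z i / z j * (z j / z j.+1) by rewrite mulrA divfK.
  by rewrite -[0](mulr0 0); apply: (local_mul lP).
have [c [i0 ci0] wc] := dependent_mod_x (fun i => z i).
pose top := [arg max_(i > i0 | (c i).[0] != 0) (i : nat)].
have [ctop top_max] : (c top).[0] != 0 /\
    forall j, (c j).[0] != 0 -> (j <= top)%N.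
  by rewrite /top; case: arg_maxnP.
have : P (\sum_i ev iota x (c i) * (z i / z top)) = Some (c top).[0].
  rewrite (bigD1 top) //= divff // mulr1 -[(c top).[0]]addr0.
  apply: (local_add lP); first exact: (local_ev lP).
  apply: (local_sum0 lP) => j jtop; have [lt_jt|le_tj] := ltnP j top.
    rewrite -[0](mulr0 (c j).[0]).
    by apply: (local_mul lP); [exact: (local_ev lP)|exact: zlt].
  have lt_tj : (top < j)%N by rewrite ltn_neqAle le_tj andbT eq_sym.
  have /eqP cj0 : (c j).[0] == 0.
    by apply: contraTT lt_tj => /top_max; rewrite -leqNgt.
  have /factor_theorem[q cE] : root (c j) 0 by apply/eqP.
  have [a Pa] : exists a, P (x / z top) = Some a.
    case: (nat_of_ord top) => [|m]; last by exists 0; exact: (zlt 0%N).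
    by exists 1; rewrite divff // (local1 lP).
  rewrite cE subr0 rmorphM /= evX.
  have -> : ev iota x q * x * (z j / z top) = ev iota x q * (x / z top) * z j.
    by field.
  rewrite -[0](mulr0 (q.[0] * a)); apply: (local_mul lP) (proj1 (Hz j)).
  by apply: (local_mul lP) Pa; exact: (local_ev lP).
under eq_bigr => j _ do rewrite mulrA.
rewrite -mulr_suml wc mul0r (local0 lP) => -[/esym/eqP].
by rewrite (negPf ctop).
Qed.

End FiniteOver.

End FunctionFieldPlace.

(** * A uniformizer is a separating element *)

Section Exchange.

Variables (K F : fieldType) (iota : {rmorphism K -> F}).

Lemma algebraic_overP t w (tr_t : transcendental iota t) :
  algebraic_over iota t w <-> algebraicOver (frac_lift tr_t) w.
Proof.
have E (f : {poly {poly K}}) :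
    (map_poly (frac_lift tr_t) (map_poly (@tofrac _) f)).[w] = ev2 iota t w f.
  rewrite -map_poly_comp ev2E; congr (_.[w]); apply: eq_map_poly => p /=.
  exact: frac_lift_tofrac.
split=> [[f f0 fw]|[q q0 /eqP qw]].
  exists (map_poly (@tofrac _) f); last by rewrite rootE E fw.
  by apply: contra_neq f0; apply: map_poly_inj0; exact: tofrac_inj0.
have [d d0 [f Ef]] := clear_denominators q.
exists f.
  apply: contra_neq q0 => f0; move/eqP: Ef.
  by rewrite f0 rmorph0 eq_sym scaler_eq0 tofrac_eq0 (negPf d0) => /eqP.
by rewrite -E Ef map_polyZ hornerZ qw mulr0.
Qed.

(** An equation of [t] over [K(x)], read as an equation of [x], shows that [x]
    is algebraic over [K(t)]; the rest is transitivity. *)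
Lemma algebraic_over_exchange x t : transcendental iota x ->
  transcendental iota t -> (forall w, algebraic_over iota x w) ->
  forall w, algebraic_over iota t w.
Proof.
move=> tr_x tr_t alg_x w.
have intx : integralOver (frac_lift tr_t) x.
  apply/integral_algebraic/algebraic_overP; have [f f0 ft] := alg_x t.
  by exists (swapXY f); rewrite ?swapXY_eq0 ?ev2_swap.
have [f f0 fw] := alg_x w.
apply/algebraic_overP/integral_algebraic.
apply: (@integral_root _ _ _ (map_poly (ev iota x) f)).
- by apply: contra_neq f0; exact: map_poly_inj0.
- by rewrite rootE -ev2E fw.
apply/integral_poly => i; rewrite coef_map /= evE.
apply: mxpoly.integral_horner => //; apply/integral_poly => j.
by rewrite coef_map /= -(evC iota t) -(frac_lift_tofrac tr_t); exact: integral_id.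
Qed.

End Exchange.

Section Separability.

Variables (K F : fieldType) (iota : {rmorphism K -> F}) (P : F -> option K).
Hypothesis placeP : rational_place iota P.
Variable t : F.
Hypotheses (t0 : t != 0) (unif_t : uniformizer P t).

Let lP : local_map iota P. Proof. exact: place_local. Qed.
Let Pt : P t = Some 0. Proof. by case: unif_t. Qed.
Let tr_t : transcendental iota t. Proof. exact: (transcendental_of_zero placeP Pt t0). Qed.

(** On [K[t]] the value of the place is the order of vanishing at 0. *)
Lemma dvd_power_of_value (B : {poly K}) m x a :
  ev iota t B = t ^+ m * x -> P x = Some a ->
  exists2 C, B = C * 'X^m & C.[0] = a.
Proof.
elim: m B => [|m IHm] B.
  rewrite mul1r => <-; rewrite (local_ev lP _ Pt) => -[<-].
  by exists B; rewrite ?expr0 ?mulr1.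
move=> BE Px; have : P (ev iota t B) = Some 0.
  have := local_mul lP Pt (local_mul lP (local_exp lP m Pt) Px).
  by rewrite mul0r mulrA -exprS -BE.
rewrite (local_ev lP _ Pt) => -[B0].
have /factor_theorem[B' B'E] : root B 0 by apply/eqP.
rewrite subr0 in B'E.
have [|C CE C0] := IHm B' _ Px.
  apply: (mulfI t0); rewrite mulrA -exprS -BE B'E rmorphM /= evX.
  exact: mulrC.
by exists C => //; rewrite B'E CE exprSr mulrA.
Qed.

(** The value of [x] is at most that of [y] when the place is finite at
    [y / x]; any two values are comparable. *)
Lemma min_value (I : eqType) (w : I -> F) (s : seq I) : (forall i, i \in s -> w i != 0) ->
  s != [::] -> exists2 i, i \in s & forall j, j \in s -> exists a, P (w j / w i) = Some a.
Proof.
elim: s => // i s IHs w0 _; have wi0 : w i != 0 by rewrite w0 // mem_head.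
have ii : exists a, P (w i / w i) = Some a.
  by exists 1; rewrite divff // (local1 lP).
have [->|s0] := eqVneq s [::].
  by exists i; rewrite ?mem_head // => j; rewrite inE => /eqP ->.
have [|k ks Hk] := IHs _ s0.
  by move=> j js; rewrite w0 // in_cons js orbT.
have wk0 : w k != 0 by rewrite w0 // in_cons ks orbT.
case E : (P (w i / w k)) => [a|].
  exists k; first by rewrite in_cons ks orbT.
  by move=> j; rewrite in_cons => /predU1P[->|/Hk //]; exists a.
have PV : P (w k / w i) = Some 0.
  rewrite -invf_div; case: placeP => [[_ _ _ PV] _]; exact: PV.
exists i; first exact: mem_head.
move=> j; rewrite in_cons => /predU1P[->//|/Hk[a Pa]].
exists (a * 0); have -> : w j / w i = w j / w k * (w k / w i) by rewrite mulrA divfK.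
exact: (local_mul lP).
Qed.

Variable p : nat.
Hypothesis charK : p \in [pchar K].

Let charF : p \in [pchar F]. Proof. by rewrite (fmorph_pchar iota). Qed.

(** The elements [t ^ j * w_i ^ p], [j < p], are linearly independent over [K]
    as soon as the [w_i] are. Since the residue field is [K], a [w_i0] of
    lowest value can be used to raise the value of the others by subtracting
    constant multiples of it; in a relation, the total coefficient of
    [w_i0 ^ p] is then divisible by [t ^ p], hence zero. *)
Lemma frobenius_independent (I : finType) (S : {set I}) (w : I -> F)
    (A : I -> {poly K}) :
  (forall c : I -> K, \sum_(i in S) iota (c i) * w i = 0 ->
     forall i, i \in S -> c i = 0) ->
  (forall i, (size (A i) <= p)%N) ->
  \sum_(i in S) ev iota t (A i) * w i ^+ p = 0 ->
  forall i, i \in S -> A i = 0.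
Proof.
have [n] := ubnP #|S|; elim: n => // n IHn in S w A * => cardS indep szA rel.
have w_neq0 i : i \in S -> w i != 0.
  move=> iS; apply/eqP => wi0.
  suff /indep/(_ i iS)/eqP : \sum_(j in S) iota (j == i)%:R * w j = 0.
    by rewrite eqxx oner_eq0.
  rewrite big1 // => j _; have [->|] := eqVneq j i; first by rewrite wi0 mulr0.
  by rewrite rmorph0 mul0r.
have [S0|/set0Pn[k kS]] := eqVneq S set0; first by move=> i; rewrite S0 inE.
have [i||i0] := @min_value _ w (enum S).
- by rewrite mem_enum; exact: w_neq0.
- by apply/eqP => S0; move: kS; rewrite -mem_enum S0.
rewrite mem_enum => i0S Hi0; have wi0 := w_neq0 _ i0S.
have /choice[c Hc] : forall i, exists a, i \in S -> P (w i / w i0) = Some a.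
  move=> i; case: (boolP (i \in S)) => [iS|_]; last by exists 0.
  by have [a Pa] := Hi0 i (etrans (mem_enum S i) iS); exists a.
pose w' i := w i - iota (c i) * w i0.
have /choice[h Hh] : forall i, exists x, i \in S ->
    w' i = t * x * w i0 /\ exists a, P x = Some a.
  move=> i; exists (w' i / w i0 / t) => iS; split; first by field; rewrite t0.
  case: unif_t => _; apply; rewrite mulrBl mulfK //.
  have := local_sub lP (Hc i iS) (local_const lP (c i)).
  by rewrite subrr.
have wp i : w i ^+ p = w' i ^+ p + iota (c i ^+ p) * w i0 ^+ p.
  rewrite -[in LHS](subrK (iota (c i) * w i0) (w i)) -(pFrobenius_autE charF).
  by rewrite pFrobenius_autD_comm ?pFrobenius_autE ?exprMn ?rmorphXn //; exact: mulrC.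
pose B := A i0 + \sum_(i in S :\ i0) (c i ^+ p) *: A i.
have relB : ev iota t B * w i0 ^+ p +
    \sum_(i in S :\ i0) ev iota t (A i) * w' i ^+ p = 0.
  rewrite -[RHS]rel [RHS](big_setD1 i0) //= {1}/B rmorphD rmorph_sum /= mulrDl -addrA.
  congr (_ + _); rewrite mulr_suml -big_split /=; apply: eq_bigr => i _.
  by rewrite (wp i) -mul_polyC rmorphM /= evC; ring.
have evB : ev iota t B =
    t ^+ p * - \sum_(i in S :\ i0) ev iota t (A i) * h i ^+ p.
  apply: (mulIf (expf_neq0 p wi0)); move/eqP: relB; rewrite addr_eq0 => /eqP ->.
  rewrite mulrN mulNr; congr (- _); rewrite mulr_sumr mulr_suml.
  apply: eq_bigr => i; rewrite in_setD1 => /andP[_ iS].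
  by rewrite (proj1 (Hh i iS)) !exprMn; ring.
have [a Pa] : exists a, P (\sum_(i in S :\ i0) ev iota t (A i) * h i ^+ p) = Some a.
  apply: (local_sum lP) => i; rewrite in_setD1 => /andP[_ iS].
  have [_ [b Pb]] := Hh i iS; exists ((A i).[0] * b ^+ p).
  by apply: (local_mul lP); [exact: (local_ev lP)|exact: (local_exp lP)].
have B0 : B = 0.
  have [C BE _] := dvd_power_of_value evB (local_opp lP Pa).
  have : (size B <= p)%N.
    rewrite (leq_trans (size_polyD _ _)) // geq_max szA /=.
    apply: (leq_trans (size_sum _ _ _)); apply/bigmax_leqP => i _.
    exact: leq_trans (size_scale_leq _ _) (szA i).
  rewrite BE; have [->|C0] := eqVneq C 0; first by rewrite mul0r.
  by rewrite size_mulXn // leqNgt -addn1 leq_add2l size_poly_gt0 C0.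
have A'0 i : i \in S :\ i0 -> A i = 0.
  apply: (IHn (S :\ i0) w') => //.
  - by move: cardS; rewrite (cardsD1 i0) i0S add1n ltnS.
  - move=> d Hd j jS; pose d0 := - \sum_(i in S :\ i0) d i * c i.
    have := indep (fun i => if i == i0 then d0 else d i).
    move=> /(_ _ j); move: jS; rewrite in_setD1 => /andP[/negPf ji0 jS].
    rewrite ji0; apply=> //.
    rewrite (big_setD1 i0) //= eqxx -[RHS]Hd rmorphN rmorph_sum /= mulNr.
    rewrite mulr_suml -sumrN -big_split /=; apply: eq_bigr => l.
    rewrite in_setD1 => /andP[/negPf -> _].
    by rewrite rmorphM /w'; ring.
  - by move: relB; rewrite B0 rmorph0 mul0r add0r.
move=> i iS; have [ii0|ii0] := eqVneq i i0; last by apply: A'0; rewrite in_setD1 ii0.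
rewrite ii0 -[RHS]B0 /B big1 ?addr0 // => j /A'0 ->.
exact: scaler0.
Qed.

End Separability.

Section Separability.

Variables (K F : fieldType) (iota : {rmorphism K -> F}) (P : F -> option K).
Hypothesis placeP : rational_place iota P.
Variable t : F.
Hypotheses (t0 : t != 0) (unif_t : uniformizer P t).

Let lP : local_map iota P. Proof. exact: place_local. Qed.
Let Pt : P t = Some 0. Proof. by case: unif_t. Qed.
Let tr_t : transcendental iota t.
Proof. exact: (transcendental_of_zero placeP Pt t0). Qed.

(** A uniformizer is a separating element: if [f] were a polynomial in the
    [p]-th power of the variable, [f] at [y] would be a relation, with
    coefficients in [K], between elements [t ^ j * (t ^ l * y ^ i) ^ p] with
    [j < p] and [i] less than the degree of [f]. *)
Lemma minimal_deriv_neq0 y f : f != 0 -> ev2 iota t y f = 0 ->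
  annihilator_degree_le iota t y f -> f^`() != 0.
Proof.
move=> f0 fy fmin; apply/eqP => f'0.
have [n sz_f] : exists n, size f = n.+2.
  case E: (size f) => [|[|n]]; last by exists n.
    by move/eqP: E; rewrite size_poly_eq0 (negPf f0).
  have /size1_polyC fC : (size f <= 1)%N by rewrite E.
  move: fy f0; rewrite fC ev2C => /tr_t ->.
  by rewrite eqxx.
have f'i i : f`_i.+1 *+ i.+1 = 0 by rewrite -coef_deriv f'0 coef0.
have [p charK] : exists p, p \in [pchar K].
  apply: (@natf0_pchar _ n.+1) => //.
  have lf : lead_coef f = f`_n.+1 by rewrite lead_coefE sz_f.
  have E := f'i n; rewrite -lf -mulr_natr in E; move/eqP: E.
  by rewrite mulf_eq0 lead_coef_eq0 (negPf f0) /= -polyC_natr polyC_eq0.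
have p_pr := pcharf_prime charK; have p_gt0 := prime_gt0 p_pr.
have fi_dvd i : f`_i != 0 -> (p %| i)%N.
  case: i => [|i] fi; first exact: dvdn0.
  have := f'i i; rewrite -mulr_natr => /eqP.
  rewrite mulf_eq0 (negPf fi) /= -polyC_natr polyC_eq0.
  by rewrite -(dvdn_pcharf charK).
have dvd_n : (p %| n.+1)%N.
  by apply: fi_dvd; rewrite -(_ : lead_coef f = f`_n.+1) ?lead_coef_eq0 // lead_coefE sz_f.
set N := (n.+1 %/ p).+1.
have NleqN : (N <= n.+1)%N by rewrite ltn_Pdiv // prime_gt1.
pose q i := f`_(i * p).
have fE : ev2 iota t y f = \sum_(i < N) ev iota t (q i) * (y ^+ i) ^+ p.
  have -> : f = \sum_(i < N) (q i)%:P * ('X ^+ i) ^+ p.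
    apply/polyP => m; rewrite coef_sum.
    under eq_bigr => i _ do rewrite -exprM coefCM coefXn.
    have [fm|fm] := eqVneq f`_m 0.
      rewrite fm big1 // => i _; have [mE|_] := eqVneq m (i * p)%N.
        by rewrite /q -mE fm mul0r.
      by rewrite mulr0.
    have /dvdnP[i mE] := fi_dvd _ fm.
    have lt_iN : (i < N)%N.
      rewrite ltnS leq_divRL // -mE -ltnS -sz_f ltnNge; apply: contra fm => le_m.
      by rewrite nth_default.
    rewrite (bigD1 (Ordinal lt_iN)) //= /q -mE eqxx mulr1 big1 ?addr0 // => j ji.
    rewrite mE eqn_pmul2r // (negPf (_ : (i != j)%N)) ?mulr0 //.
    by apply: contra ji => /eqP ij; rewrite -val_eqE /= ij.
  rewrite rmorph_sum; apply: eq_bigr => i _.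
  by rewrite rmorphM !rmorphXn /= ev2C ev2X.
pose M := (\max_(i < N) size (q i)).
have szq (i : 'I_N) : (size (q i) <= M * p)%N.
  rewrite (leq_trans (leq_bigmax (F := fun i : 'I_N => size (q i)) i)) //.
  by rewrite leq_pmulr.
(* [y ^ i * t ^ j] to the [p]-th power has as coefficient in [f] the [j]-th digit
   of [q i] in base ['X^p] *)
pose w (ij : 'I_N * 'I_M) := y ^+ ij.1 * t ^+ ij.2.
pose A (ij : 'I_N * 'I_M) := \poly_(l < p) (q ij.1)`_(ij.2 * p + l).
have sumT (E : 'I_N * 'I_M -> F) :
    \sum_(ij in [set: 'I_N * 'I_M]) E ij = \sum_i \sum_j E (i, j).
  by rewrite pair_bigA; apply: eq_big => -[i j]; rewrite ?inE.
have A0 : forall ij, ij \in [set: 'I_N * 'I_M] -> A ij = 0.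
  apply: (frobenius_independent placeP t0 unif_t charK (w := w)).
  - move=> c Hc [i j] _.
    pose g : {poly {poly K}} := \poly_(i < N) \poly_(j < M)
      (if insub i is Some i' then if insub j is Some j' then c (i', j') else 0 else 0).
    have gy : ev2 iota t y g = 0.
      rewrite ev2_poly -[RHS]Hc sumT.
      apply: eq_bigr => i' _; rewrite ev_poly mulr_suml; apply: eq_bigr => j' _.
      by rewrite !valK /w /=; ring.
    have g0 : g = 0.
      apply/eqP; apply: contraT => g0; have := fmin _ gy g0.
      by rewrite leqNgt (leq_trans _ (_ : n.+2 <= _)%N) ?sz_f // ltnS (leq_trans (size_poly _ _)).
    have := congr1 (fun r : {poly {poly K}} => r`_i`_j) g0.
    by rewrite coef_poly ltn_ord coef_poly ltn_ord !coef0 !valK.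
  - by move=> ij; exact: size_poly.
  rewrite sumT -[RHS]fy fE.
  apply: eq_bigr => i _; rewrite (poly_base_Xn p_gt0 (szq i)).
  rewrite rmorph_sum mulr_suml; apply: eq_bigr => j _.
  by rewrite rmorphM rmorphXn /= evX /w /= exprMn [t ^+ (_ * _)]exprM [RHS]mulrAC mulrA.
case/eqP: f0; apply/polyP => m; rewrite coef0; apply/eqP; apply: contraT => fm.
have /dvdnP[i mE] := fi_dvd _ fm.
have lt_iN : (i < N)%N.
  rewrite ltnS leq_divRL // -mE -ltnS -sz_f ltnNge; apply: contra fm => le_m.
  by rewrite nth_default.
case/eqP: fm; rewrite mE -/(q i) (poly_base_Xn p_gt0 (szq (Ordinal lt_iN))) big1 // => j _.
by have := A0 (Ordinal lt_iN, j) (in_setT _); rewrite /A /= => ->; rewrite mul0r.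
Qed.

End Separability.

(** * Generation by a uniformizer and one more element *)

Section PrimitiveElement.

Variables (K F : fieldType) (iota : {rmorphism K -> F}) (P : F -> option K).
Hypothesis placeP : rational_place iota P.
Variable t : F.
Hypotheses (t0 : t != 0) (unif_t : uniformizer P t).
Hypothesis alg_t : forall w, algebraic_over iota t w.

Let tr_t : transcendental iota t.
Proof. by apply: (transcendental_of_zero placeP) => //; case: unif_t. Qed.

Let phi := frac_lift tr_t.

Let phi_tofrac p : phi (tofrac p) = ev iota t p.
Proof. exact: frac_lift_tofrac. Qed.

Let phi_map (f : {poly {poly K}}) y :
  (map_poly phi (map_poly (@tofrac _) f)).[y] = ev2 iota t y f.
Proof.
rewrite -map_poly_comp ev2E; congr (_.[y]); apply: eq_map_poly => p /=.
exact: phi_tofrac.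
Qed.

(** The gcd of the minimal equation of [y] and its derivative has lower degree,
    because the derivative is not zero. Hence it does not vanish at [y], the
    complementary factor does, and by minimality this factor has full degree. *)
Lemma separable_over y :
  exists2 q : {poly {fraction {poly K}}}, separable_poly q & root (map_poly phi q) y.
Proof.
have [f [f0 fy fmin]] := minimal_annihilator (alg_t y).
have f'0 := minimal_deriv_neq0 placeP t0 unif_t f0 fy fmin.
set q := map_poly (@tofrac _) f.
have qmin d : d != 0 -> root (map_poly phi d) y -> (size q <= size d)%N.
  move=> d0 /eqP dy; have [c c0 [g Eg]] := clear_denominators d.
  have cF0 : tofrac c != 0 by rewrite tofrac_eq0.
  rewrite size_map_tofrac -(size_scale d cF0) -Eg size_map_tofrac.
  apply: fmin; first by rewrite -phi_map Eg map_polyZ hornerZ dy mulr0.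
  apply: contra_neq d0 => g0; move/eqP: Eg.
  by rewrite g0 rmorph0 eq_sym scaler_eq0 (negPf cF0) => /eqP.
have q0 : q != 0 by apply: contra_neq f0; apply: map_poly_inj0; exact: tofrac_inj0.
have q'0 : q^`() != 0.
  rewrite deriv_map; apply: contra_neq f'0; apply: map_poly_inj0.
  exact: tofrac_inj0.
have qy : root (map_poly phi q) y by rewrite rootE phi_map fy.
exists q => //; rewrite unlock.
set d := gcdp q q^`(); have d0 : d != 0 by rewrite gcdp_eq0 negb_and q0.
have qE : q = q %/ d * d by rewrite divpK // dvdp_gcdl.
have qd0 : q %/ d != 0 by apply: contraNneq q0 => qd0; rewrite qE qd0 mul0r.
move: qy; rewrite {1}qE rmorphM rootM => /orP[/(qmin _ qd0)|/(qmin _ d0)].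
  rewrite {1}qE size_mul // /coprimep -/d.
  have := d0; rewrite -size_poly_gt0; case: (size d) => // n _.
  by rewrite addnS /= -{2}[size _]addn0 leq_add2l leqn0 eqSS.
rewrite leqNgt; case/negP; apply: leq_ltn_trans (lt_size_deriv q0).
by apply: dvdp_leq; rewrite // dvdp_gcdr.
Qed.

Definition generated_by z w :=
  exists q : {poly {fraction {poly K}}}, (map_poly phi q).[z] = w.

Lemma generated_by_trans z y w :
  generated_by z y -> generated_by y w -> generated_by z w.
Proof.
move=> [p pz] [q qy]; exists (q \Po p).
by rewrite map_comp_poly horner_comp pz.
Qed.

Lemma primitive_element (s : seq F) :
  exists y, forall w, w \in s -> generated_by y w.
Proof.
elim: s => [|x s [y IHs]]; first by exists 0.
have [q sep_q qy] := separable_over y.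
have [p sep_p px] := separable_over x.
have [r r0 PETr] := large_field_PET (separable_poly_neq0 sep_p) px qy sep_q.
(* the powers of [t] are infinitely many elements of the base field *)
have inj_t : injective (fun n => phi (tofrac ('X^n : {poly K}))).
  move=> i j /=; rewrite !phi_tofrac => /eqP; rewrite -subr_eq0 -rmorphB.
  move=> /eqP/tr_t/eqP; rewrite subr_eq0 => /eqP/(congr1 (size \o val)) /=.
  by rewrite !size_polyXn => -[].
have [n /PETr[zx zy]] := injective_avoids_roots inj_t r0.
eexists => w; rewrite in_cons => /predU1P[->|/IHs yw]; first exact: zx.
exact: generated_by_trans zy yw.
Qed.

Lemma generated_by_frac (y w : F) : generated_by y w -> frac_of (ev2 iota t y) w.
Proof.
move=> [q <-]; apply: frac_of_horner => [i|].
  by rewrite coef_map; apply: frac_of_ev_ev2; exact: frac_of_lift.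
exact: frac_of_gen.
Qed.

(** A primitive element for [x] and the basis [e] generates [F], although the
    coefficients of elements of [F] in this basis are fractions in [x], not in
    [t]. *)
Lemma plane_generator (x : F) (e : seq F) : spans_over iota x e ->
  exists y : F, forall w : F, frac_of (ev2 iota t y) w.
Proof.
move=> fin_e; have [y Hy] := primitive_element (x :: e); exists y => w.
have [c [Hc ->]] := fin_e w.
have xg : frac_of (ev2 iota t y) x by apply/generated_by_frac/Hy/mem_head.
apply: frac_of_sum => i _; apply: frac_ofM; last first.
  by apply/generated_by_frac/Hy; rewrite in_cons mem_nth ?orbT.
have [p [q [q0 ->]]] := Hc i.
have evg r : frac_of (ev2 iota t y) (ev iota x r).
  rewrite evE; apply: frac_of_horner => // j.
  rewrite coef_map /= -(evC iota t) -(ev2C iota t y); exact: frac_of_ev2.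
by apply: frac_ofM => //; apply: frac_ofV.
Qed.

End PrimitiveElement.

(** * Rational points near a rational place *)

Section SmoothModel.

Variables (K F : fieldType) (iota : {rmorphism K -> F}) (P : F -> option K).
Hypothesis placeP : rational_place iota P.
Variable t : F.
Hypotheses (t0 : t != 0) (unif_t : uniformizer P t).
Hypothesis alg_t : forall w, algebraic_over iota t w.

Let lP : local_map iota P. Proof. exact: place_local. Qed.
Let Pt : P t = Some 0. Proof. by case: unif_t. Qed.
Let tr_t : transcendental iota t.
Proof. exact: (transcendental_of_zero placeP Pt t0). Qed.

Lemma frac_of_ev2_change y z w : frac_of (ev2 iota t z) y ->
  frac_of (ev2 iota t y) w -> frac_of (ev2 iota t z) w.
Proof.
move=> zy [p [q [q0 ->]]].
have ez r : frac_of (ev2 iota t z) (ev2 iota t y r).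
  rewrite ev2E; apply: frac_of_horner => // i; rewrite coef_map /=.
  by rewrite -(ev2C iota t z); exact: frac_of_ev2.
by apply: frac_ofM => //; apply: frac_ofV.
Qed.

Lemma truncated_expansion N y c : P y = Some c ->
  exists y0 z d, P z = Some d /\ y = ev iota t y0 + t ^+ N * z.
Proof.
move=> Py; elim: N => [|N [y0 [z [d [Pz yE]]]]].
  by exists 0, y, c; rewrite rmorph0 add0r mul1r.
have Pzd : P (z - iota d) = Some 0.
  by have := local_sub lP Pz (local_const lP d); rewrite subrr.
have [d' Pz'] := proj2 unif_t _ Pzd.
exists (y0 + d%:P * 'X^N), ((z - iota d) / t), d'; split=> //.
by rewrite yE rmorphD rmorphM rmorphXn /= evC evX exprS; field.
Qed.

(** The point may remain singular, but it meets Newton's criterion. Start from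
    a generator finite at the place, let [k] be the value of the derivative of
    its equation, and subtract the truncation up to order [k] of its expansion
    in powers of [t]. The derivative at the new generator [y'] is the same, and
    differs from the linear coefficient [f1] of the new equation by a multiple
    of [y'], of value greater than [k]; so [f1] has value [k]. The constant
    coefficient is [- f1 * y'] up to a multiple of [y' ^ 2], hence has value at
    least [2 k + 1]. *)
Lemma newton_model : (exists y, forall w, frac_of (ev2 iota t y) w) ->
  exists y f k A B, [/\ forall w, frac_of (ev2 iota t y) w, f != 0,
    ev2 iota t y f = 0, annihilator_degree_le iota t y f &
    [/\ f`_0 = A * 'X^(k.*2.+1), f`_1 = B * 'X^k & B.[0] != 0]].
Proof.
move=> [y1 gen1].
have [y [c [Py gen]]] : exists y c, P y = Some c /\ forall w, frac_of (ev2 iota t y) w.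
  case E : (P y1) => [c|]; first by exists y1, c.
  exists y1^-1, 0; split; first by case: placeP => [[_ _ _ PV] _]; exact: PV.
  move=> w; apply: frac_of_ev2_change (gen1 w).
  by rewrite -[X in frac_of _ X]invrK; apply/frac_ofV/frac_of_gen.
have [f [f0 fy fmin]] := minimal_annihilator (alg_t y).
have f'0 := minimal_deriv_neq0 placeP t0 unif_t f0 fy fmin.
set D := ev2 iota t y f^`().
have D0 : D != 0.
  apply/eqP => /fmin/(_ f'0); rewrite leqNgt; case/negP.
  exact: lt_size_deriv.
have [k [u [cu [cu0 Pu DE]]]] : exists k u c,
    [/\ c != 0, P u = Some c & D = u * t ^+ k].
  have := @unit_times_power _ _ _ _ lP t 0 D _ Pt.
  rewrite rmorph0 subr0; apply=> //; exact: (local_ev2 lP _ Pt Py).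
have [y0 [z [d [Pz yE]]]] := truncated_expansion k.+1 Py.
set y' := t ^+ k.+1 * z in yE.
have shift g : ev2 iota t y' (g \Po ('X + y0%:P)) = ev2 iota t y g.
  by rewrite ev2_shift yE addrC.
have unshift g : ev2 iota t y (g \Po ('X - y0%:P)) = ev2 iota t y' g.
  rewrite -polyCN ev2_shift (@rmorphN {poly K} F (ev iota t)) yE.
  by rewrite addrAC subrr add0r.
pose f1 := f \Po ('X + y0%:P).
have Py' : P y' = Some 0.
  have := local_mul lP (local_exp lP k.+1 Pt) Pz.
  by rewrite expr0n mul0r.
have f1y : ev2 iota t y' f1 = 0 by rewrite shift.
have f1'y : ev2 iota t y' f1^`() = D.
  by rewrite deriv_comp derivD derivX derivC addr0 mulr1 shift.
have [h hE] : exists h, f1^`() = h * 'X + (f1`_1)%:P.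
  exists (drop_poly 1 f1^`()).
  rewrite -[LHS](poly_take_drop 1) addrC expr1; congr (_ + _).
  by rewrite /take_poly poly_def big_ord1 coef_deriv expr0 alg_polyC.
have [g gE] : exists g, f1 = (g * 'X + (f1`_1)%:P) * 'X + (f1`_0)%:P.
  exists (drop_poly 2 f1).
  rewrite -[LHS](poly_take_drop 2) addrC mulrDl -mulrA -expr2 -addrA.
  congr (_ + _); rewrite /take_poly poly_def big_ord_recl big_ord1 /=.
  by rewrite expr0 alg_polyC expr1 mul_polyC addrC.
have [H PH] : exists H, P (ev2 iota t y' h) = Some H.
  by eexists; exact: (local_ev2 lP _ Pt Py').
have [G PG] : exists G, P (ev2 iota t y' g) = Some G.
  by eexists; exact: (local_ev2 lP _ Pt Py').
pose u' := u - t * (z * ev2 iota t y' h).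
have Pu' : P u' = Some cu.
  have := local_sub lP Pu (local_mul lP Pt (local_mul lP Pz PH)).
  by rewrite mul0r subr0.
have ev1 : ev iota t f1`_1 = t ^+ k * u'.
  have := f1'y; rewrite hE rmorphD rmorphM /= ev2X ev2C DE => E1.
  apply: (addrI (ev2 iota t y' h * y')); rewrite E1 /u'.
  by move: (ev2 _ _ _ h) => H'; rewrite /y' exprS; ring.
have ev0 : ev iota t f1`_0 =
    t ^+ k.*2.+1 * - (z * u' + t * (z * (z * ev2 iota t y' g))).
  have E0 := f1y; rewrite {1}gE rmorphD rmorphM rmorphD rmorphM /= in E0.
  move: E0; rewrite !ev2X !ev2C ev1.
  move: (ev2 _ _ _ g) => G' E0; apply: (addrI ((G' * y' + t ^+ k * u') * y')).
  by rewrite E0 /y' -addnn ![t ^+ _.+1]exprS exprD; ring.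
have [B BE B0] := dvd_power_of_value placeP t0 unif_t ev1 Pu'.
have [A AE _] := dvd_power_of_value placeP t0 unif_t ev0
  (local_opp lP (local_add lP (local_mul lP Pz Pu')
    (local_mul lP Pt (local_mul lP Pz (local_mul lP Pz PG))))).
exists y', f1, k, A, B; split=> //.
- move=> w; apply: frac_of_ev2_change (gen w).
  rewrite yE; apply: frac_ofD; last exact: frac_of_gen.
  by rewrite -(ev2C iota t y'); exact: frac_of_ev2.
- apply: contra_neq f0 => f10; apply/eqP; rewrite -size_poly_eq0.
  by rewrite -(@size_comp_poly2 _ f ('X + y0%:P)) ?size_XaddC // -/f1 f10 size_poly0.
- move=> r ry r0; rewrite size_comp_poly2 ?size_XaddC //.
  rewrite -(@size_comp_poly2 _ r ('X - y0%:P)) ?size_XsubC //.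
  apply: fmin; first by rewrite unshift.
  by rewrite -size_poly_eq0 size_comp_poly2 ?size_XsubC // size_poly_eq0.
- by split=> //; rewrite B0.
Qed.

End SmoothModel.

Section ManyPlaces.

Variables (K : fieldType) (G : porderZmodType) (v : K -> option G).
Hypotheses (valv : valuation v) (ntv : nontrivial_valuation v).
Hypothesis hensv : henselian v.

(** Once the coefficients of [f] are made integral by a factor [l], take
    [a = d ^ 2 * s] with [d] the value of [l * B] at 0 and [s] in the maximal
    ideal. Then [l * B] takes at [a] the value [d] times a unit, and the quotient
    in Newton's criterion for [f(a, Z)] is [a * (l * A)(a) / (l * B)(a) ^ 2],
    that is [s] times an integral element. The powers of a single [s] give
    infinitely many [a], so one of them avoids the roots of [R]. *)
Lemma newton_points (f : {poly {poly K}}) k (A B R : {poly K}) :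
    f`_0 = A * 'X^(k.*2.+1) -> f`_1 = B * 'X^k -> B.[0] != 0 -> R != 0 ->
  exists a b, [/\ R.[a] != 0, f.[b%:P].[a] = 0 & f^`().[b%:P].[a] != 0].
Proof.
move=> f0E f1E B0 R0.
have [l l0 Hl] := common_scale valv (flatten [seq polyseq p | p <- f]).
have Of i j : valint v (l * f`_i`_j).
  have [lt_i|le_i] := ltnP i (size f); last first.
    by rewrite [f`_i]nth_default // coef0 mulr0 (valint0 valv).
  have [lt_j|le_j] := ltnP j (size f`_i); last first.
    by rewrite [_`_j]nth_default // mulr0 (valint0 valv).
  apply: Hl; apply/flattenP; exists (polyseq f`_i); last exact: mem_nth.
  by apply: map_f; exact: mem_nth.
have Oscale (p : {poly K}) x :
    (forall j, valint v (l * p`_j)) -> valint v x -> valint v (l * p.[x]).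
  move=> Op Ox; rewrite -hornerZ; apply: (valint_horner valv) => // j.
  by rewrite coefZ.
have OA j : valint v (l * A`_j).
  by have := Of 0%N (j + k.*2.+1)%N; rewrite f0E coefMXn ltnNge leq_addl addnK.
have OB j : valint v (l * B`_j).
  by have := Of 1%N (j + k)%N; rewrite f1E coefMXn ltnNge leq_addl addnK.
have [s s0 Ms] := exists_small valv ntv.
pose d := l * B.[0]; have d0 : d != 0 by rewrite mulf_neq0.
have Od : valint v d by apply: Oscale => //; exact: valint0.
pose a n := d ^+ 2 * s ^+ n.+1.
have inj_a : injective a.
  move=> i j /(mulfI (expf_neq0 2 d0)) /(small_powers_inj valv s0 Ms).
  by case.
have [n Ra] := injective_avoids_roots inj_a R0.
have Msn : small_elt v (s ^+ n.+1) by exact: smallX.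
have a0 : a n != 0 by rewrite mulf_neq0 ?expf_neq0.
have aE : a n = d ^+ 2 * s ^+ n.+1 by [].
move: (a n) (s ^+ n.+1) Ra a0 aE Msn => x sn Ra a0 aE Msn.
have Ox : valint v x.
  by rewrite aE (valintM valv) ?(valintX valv) // smallW.
pose B' := drop_poly 1 B.
have BE : B = B' * 'X + (B.[0])%:P.
  rewrite -[LHS](poly_take_drop 1) addrC expr1; congr (_ + _).
  by rewrite /take_poly poly_def big_ord1 expr0 alg_polyC horner_coef0.
have OB' : valint v (l * B'.[x]).
  by apply: Oscale => // j; rewrite coef_drop_poly.
pose w := 1 + sn * (d * (l * B'.[x])).
have [Ow nMw OwV] := unit_near1 valv (smallM valv Msn (valintM valv Od OB')).
have w0 : w != 0 by apply: contraNneq nMw => ww; rewrite -/w ww (small0 valv).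
have Bx : l * B.[x] = d * w.
  by rewrite BE hornerMXaddC mulrDr -/d /w {2}aE; ring.
pose q : {poly K} := map_poly (horner_eval x) (l%:P *: f).
have qE i : q`_i = l * (f`_i).[x].
  by rewrite coef_map coefZ /= /horner_eval hornerCM.
have [|||b qb q'b] := @newton_root _ _ _ valv hensv q.
- by move=> i; rewrite qE; apply: Oscale => // j; exact: Of.
- rewrite qE f1E hornerM hornerXn mulrA Bx.
  by rewrite !mulf_neq0 // expf_neq0.
- rewrite !qE f0E f1E !hornerM !hornerXn !mulrA Bx.
  have {}OwV : valint v w^-1 by [].
  clearbody d w.
  have -> : l * A.[x] * x ^+ k.*2.+1 / (d * w * x ^+ k) ^+ 2 =
      sn * (l * A.[x] * (w^-1 * w^-1)).
    rewrite !exprMn -exprM muln2 exprSr; have xk0 := expf_neq0 k.*2 a0.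
    move: (x ^+ k.*2) xk0 (A.[x]) => xk xk0 Ax; rewrite aE; field.
    by rewrite w0 d0 xk0.
  apply: (smallM valv) => //; apply: (valintM valv); first exact: Oscale.
  exact: (valintM valv).
have evq (g : {poly {poly K}}) : (map_poly (horner_eval x) g).[b] = g.[b%:P].[x].
  by have := horner_map (horner_eval x) g b%:P; rewrite /= /horner_eval hornerC.
exists x, b; split=> //.
  move/eqP: qb; rewrite evq hornerZ hornerCM => /eqP.
  by rewrite mulf_eq0 (negPf l0) => /eqP.
apply: contra_neq q'b => f'b.
by rewrite deriv_map derivZ evq hornerZ hornerCM f'b mulr0.
Qed.

(** The polynomial [R] serves to avoid any given finite set of values of [t];
    the zeros of the leading coefficient of the equation of the curve are
    avoided in the same way. *)
Lemma many_rational_places (F : fieldType) (iota : {rmorphism K -> F}) :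
  function_field_one_var iota -> (exists P, rational_place iota P) ->
  exists t, forall R : {poly K}, R != 0 ->
    exists2 a, R.[a] != 0 & exists2 P, rational_place iota P & P t = Some a.
Proof.
move=> ffF [P placeP].
have [x [e [Px x0 fin_e]]] := zero_spans_over placeP ffF.
have [t t0 unif_t] := uniformizer_exists placeP Px x0 fin_e.
have tr_x := transcendental_of_zero placeP Px x0.
have tr_t := transcendental_of_zero placeP (proj1 unif_t) t0.
have alg_t := algebraic_over_exchange tr_x tr_t
  (algebraic_of_spans_over fin_e).
have [y [f [k [A [B [gen f0 fy fmin [f0E f1E B0]]]]]]] :=
  newton_model placeP t0 unif_t alg_t
    (plane_generator placeP t0 unif_t alg_t fin_e).
exists t => R R0.
have RL0 : R * lead_coef f != 0 by rewrite mulf_neq0 // lead_coef_eq0.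
have [a [b [Ra fab f'ab]]] := newton_points f0E f1E B0 RL0.
move: Ra; rewrite hornerM mulf_eq0 negb_or => /andP[Ra La].
by exists a => //; exact: (smooth_point_place tr_t alg_t gen fy fmin fab f'ab La).
Qed.

End ManyPlaces.

Theorem proposition16 (K : fieldType)
  (hK : admits_nontrivial_henselian_valuation K) : large K.
Proof.
move=> F iota ffF exP finP.
have [G [v [valv ntv hensv]]] := hK.
have [t many] := many_rational_places valv ntv hensv ffF exP.
have /cardinality.finite_seqP[s sE] :=
  cardinality.finite_image (fun P : F -> option K => P t) finP.
(* [R] vanishes at the finite values of [t] at all rational places *)
pose R : {poly K} := \prod_(o <- s) if o is Some c then 'X - c%:P else 1.
have R0 : R != 0.
  by rewrite prodf_seq_neq0; apply/allP => -[c|] _; rewrite ?polyXsubC_eq0 ?oner_neq0.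
have [a /negP Ra [P placeP Pt]] := many R R0; apply: Ra.
have sa : Some a \in s.
  suff : classical_sets.mkset (fun o => o \in s) (Some a) by [].
  by rewrite -sE; exists P.
rewrite /R horner_prod prodf_seq_eq0; apply/hasP; exists (Some a) => //=.
by rewrite hornerXsubC subrr.
Qed.
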